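(* Let $Z$ be a standard normal random variable. (i) Let $\beta>0$ be real, and let $X_1,\dots,X_n$ be independent random variables with $\mathsf{E} X_i\le0$ for all $i$, $\sum_{i=1}^n\mathsf{E} X_i^2\le1$, and $\sum_{i=1}^n\mathsf{E}(X_i)_+^3\le\beta$. Let $S:=X_1+\dots+X_n$. Then for all real $x$ $$\mathsf{E}(S-x)_+^3\le\mathsf{E}(Z-x)_+^3+\beta.$$ (ii) If, in addition to the assumptions in (i), $\mathsf{E} X_i=0$ for all $i$, then for all real $x$ $$\mathsf{E}|S-x|^3\le\mathsf{E}|Z-x|^3+\sum_{i=1}^n\mathsf{E}|X_i|^3.$$ (iii) For each real $x$ the upper bound in (ii) is exact, in the following sense: for each real $\gamma>0$, the supremum of $\mathsf{E}|S-x|^3$ over all finite families of independent random variables $X_1,\dots,X_n$ (with $n$ arbitrary and $S:=X_1+\dots+X_n$) such that $\mathsf{E} X_i=0$ for all $i$, $\sum_{i=1}^n\mathsf{E} X_i^2\le1$, and $\sum_{i=1}^n\mathsf{E}|X_i|^3\le\gamma$ equals $\mathsf{E}|Z-x|^3+\gamma$.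
   Context: Notation: $x_+:=\max(0,x)$ and $x_+^3:=(x_+)^3$ for real $x$. The inequality in (ii) is trivial when $\sum_i\mathsf{E}|X_i|^3=\infty$. *)

(* Defs.v *)
From HB Require Import structures.
From mathcomp Require Import all_boot all_order all_algebra.
From mathcomp Require Import all_classical all_reals all_analysis.

Set Implicit Arguments.
Unset Strict Implicit.
Unset Printing Implicit Defensive.

Import Order.TTheory GRing.Theory Num.Theory.
Import numFieldNormedType.Exports.

Local Open Scope classical_set_scope.
Local Open Scope ring_scope.

Definition pos_part (R : realType) (x : R) : R := Num.max 0 x.

(* Mutual independence: the product rule is required for every finite
   subfamily, and only at measurable events. *)
Definition independent_RVs (R : realType) (d : measure_display)
    (T : measurableType d) (P : probability T R) (n : nat)
    (X : 'I_n -> {RV P >-> R}) : Prop :=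
  forall (J : {set 'I_n}) (B : 'I_n -> set R),
    (forall i, i \in J -> measurable (B i)) ->
    P (\bigcap_(i in [set` J]) (X i @^-1` B i)) =
    (\prod_(i in J) P (X i @^-1` B i))%E.

(* The laws are compared on measurable sets only: the value of a measure on a
   non-measurable set carries no information. *)
Definition standard_normal (R : realType) (d : measure_display)
    (T : measurableType d) (P : probability T R) (Z : {RV P >-> R}) : Prop :=
  forall A : set R, measurable A -> distribution P Z A = normal_prob 0 1 A.

(* Main.v *)
(** Lindeberg's replacement method with a third-order remainder.  The function
    [f u = (u - x)_+^3] satisfies [f (u + y) <= f u + f' u y + f'' u y^2 / 2 + y_+^3],
    while convexity of [f''] gives, for a centred normal [G] of variance [s^2],
    [E f (u + G) >= f u + f'' u s^2 / 2].  Hence replacing one summand [X_i] by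
    an independent normal of the same variance raises [E f] up to an error of
    [E (X_i)_+^3]; smoothing [f] by the remaining normals first preserves this
    by Tonelli, and the normals recombine since they are stable under
    convolution.  This gives (i), and (ii) follows by adding (i) for [X] at [x]
    and for [- X] at [- x], as [|u|^3 = u_+^3 + (- u)_+^3].

    For (iii), let [S] consist of many small normals of total variance
    [(1 - r)^2] and one symmetric jump [J] with [E |J|^3 = gamma - r] and
    [E J^2 = 1 - (1 - r)^2], which is nonzero with small probability [p].  By
    convexity of [|.|^3] the jump adds at least [E |J|^3] to
    [(1 - p) E |(1 - r) Z - x|^3], and [r -> 0] gives the supremum. *)

Require Import Defs.
From HB Require Import structures.
From mathcomp Require Import all_boot all_order all_algebra.
From mathcomp Require Import all_classical all_reals all_analysis.
From mathcomp Require Import measurable_realfun.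
From mathcomp Require Import ring lra.

Set Implicit Arguments.
Unset Strict Implicit.
Unset Printing Implicit Defensive.

Import Order.TTheory GRing.Theory Num.Theory.
Import numFieldNormedType.Exports.

Local Open Scope classical_set_scope.
Local Open Scope ring_scope.

(** * The standard normal law *)

Section normal.
Context {R : realType}.
Local Notation mu := (@lebesgue_measure R).

Definition std_normal : probability (measurableTypeR R) R := normal_prob 0 1.

(** [normal_prob] is dominated by Lebesgue measure, and its Radon-Nikodym derivative agrees almost
    everywhere with [normal_pdf], since both have the same integral over every measurable set. *)
Lemma ge0_integral_normal_prob (m s : R) (f : R -> \bar R) :
  measurable_fun [set: R] f -> (forall x, 0 <= f x)%E ->
  (\int[normal_prob m s]_x f x = \int[mu]_x (f x * (normal_pdf m s x)%:E))%E.
Proof.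
move=> mf f0.
have dom := @normal_prob_dominates R m s.
rewrite -(Radon_Nikodym_SigmaFinite.change_of_variables dom)//.
have mpdf : measurable_fun [set: R] (fun x => (normal_pdf m s x)%:E).
  by apply/measurable_EFinP; exact: measurable_normal_pdf.
have mRN := measurable_int _ (Radon_Nikodym_SigmaFinite.f_integrable dom).
apply: ge0_ae_eq_integral => //.
- exact: emeasurable_funM.
- exact: emeasurable_funM.
- by move=> x _; rewrite mule_ge0// Radon_Nikodym_SigmaFinite.f_ge0.
- by move=> x _; rewrite mule_ge0// lee_fin normal_pdf_ge0.
- apply: ae_eqe_mul2l; apply: integral_ae_eq => //.
    exact: Radon_Nikodym_SigmaFinite.f_integrable.
  by move=> E _ mE; rewrite -Radon_Nikodym_SigmaFinite.f_integral.
Qed.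

Lemma normal_pdf_affine (m s y : R) : 0 < s ->
  normal_pdf m s (m + s * y) * s = normal_pdf 0 1 y.
Proof.
move=> s0; rewrite !normal_pdfE ?gt_eqF ?oner_neq0//.
rewrite /normal_peak /normal_fun expr1n mul1r subr0 -mulrnAr.
rewrite sqrtrM ?sqr_ge0// sqrtr_sqr gtr0_norm// invfM mulrAC.
rewrite (mulrAC _ _ s) mulVf ?gt_eqF// mul1r; congr (_ * expR _).
by rewrite (addrC m) addrK; field; rewrite gt_eqF.
Qed.

(** Substitution [x = m + s * z]; the Jacobian [s] is absorbed by [normal_pdf_affine]. *)
Lemma integral_normal_prob_affine (m s : R) (h : R -> R) : 0 < s ->
  continuous h -> (forall x, 0 <= h x) ->
  (\int[std_normal]_z (h (m + s * z))%:E = \int[normal_prob m s]_x (h x)%:E)%E.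
Proof.
move=> s0 ch h0.
have caff : continuous (fun z : R => m + s * z).
  move=> z; apply: cvgD; first exact: cvg_cst.
  by apply: cvgM; [exact: cvg_cst|exact: cvg_id].
have F' : derive1 (fun z : R => m + s * z) = cst s.
  apply/funext => z; rewrite derive1E deriveD// ?derive_cst ?add0r//.
  by rewrite deriveM// derive_cst derive_id scaler0 addr0 [_ *: _]mulr1.
rewrite !ge0_integral_normal_prob; last first.
- by move=> x; rewrite lee_fin.
- by apply/measurable_EFinP; exact: continuous_measurable_fun.
- by move=> x; rewrite lee_fin.
- apply/measurable_EFinP; apply: continuous_measurable_fun => z.
  by apply: continuous_comp; [exact: caff|exact: ch].
under eq_integral do rewrite -EFinM.
under [RHS]eq_integral do rewrite -EFinM.
rewrite (@increasing_ge0_integration_by_substitutionT _ (fun z => m + s * z)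
  (fun x => h x * normal_pdf m s x)).
- apply: eq_integral => z _; congr EFin.
  by rewrite F' /= !fctE/= -mulrA normal_pdf_affine.
- by move=> x y xy; rewrite ltrD2l ltr_pM2l.
- by rewrite F'; move=> ?; exact: cvg_cst.
- by rewrite F'; exact: is_cvg_cst.
- by rewrite F'; exact: is_cvg_cst.
- by move=> x; apply: derivableD => //; apply: derivableM.
- under eq_fun do rewrite addrC mulrC.
  by apply: cvg_comp (@cvg_addrr_Ny _ m); apply: gt0_cvgMlNy.
- under eq_fun do rewrite addrC mulrC.
  by apply: cvg_comp (@cvg_addrr _ m); apply: gt0_cvgMly.
- move=> x; apply: cvgM; first exact: ch.
  by apply: continuous_normal_pdf; rewrite gt_eqF.
- by move=> x; rewrite mulr_ge0// normal_pdf_ge0.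
Qed.
End normal.

Lemma integral_probability_cst d (T : measurableType d) (R : realType)
    (P : probability T R) (r : \bar R) : (\int[P]_x r = r)%E.
Proof. by rewrite integral_cst// [X in (_ * X)%E]probability_setT mule1. Qed.

(** * Tonelli's theorem in curried form *)

Section tonelli.
Context d1 d2 (T1 : measurableType d1) (T2 : measurableType d2) (R : realType).
Variables (m1 : {sigma_finite_measure set T1 -> \bar R}).
Variables (m2 : {sigma_finite_measure set T2 -> \bar R}).
Variable f : T1 -> T2 -> \bar R.
Hypothesis mf : measurable_fun [set: T1 * T2] (fun p => f p.1 p.2).
Hypothesis f0 : forall x y, (0 <= f x y)%E.

Lemma measurable_fun_integral :
  measurable_fun [set: T1] (fun x => \int[m2]_y f x y)%E.
Proof.
exact: (@measurable_fun_fubini_tonelli_F _ _ _ _ _ m2 (fun p => f p.1 p.2)).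
Qed.

Lemma integral_exchange :
  (\int[m1]_x \int[m2]_y f x y = \int[m2]_y \int[m1]_x f x y)%E.
Proof. exact: (@fubini_tonelli _ _ _ _ _ m1 m2 (fun p => f p.1 p.2)). Qed.

End tonelli.

(** * Stability of centred normal laws under convolution *)

Section conv.
Context {R : realType}.
Local Notation mu := (@lebesgue_measure R).
Local Notation gauss := (@std_normal R).

(** Completing the square in [x]. The left side is the joint density of [x] and [z = a * x + b * y]
    for independent standard normals [x], [y]; the right side factors it into the marginal density
    of [z] and the conditional density of [x] given [z]. *)
Lemma normal_pdf_convolution (a b x z : R) : 0 < b ->
  let c := Num.sqrt (a ^+ 2 + b ^+ 2) in
  normal_pdf 0 1 x * normal_pdf (a * x) b z =
  normal_pdf 0 c z * normal_pdf (a * z / c ^+ 2) (b / c) x.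
Proof.
move=> b0 c.
have ab0 : 0 < a ^+ 2 + b ^+ 2 by rewrite ltr_wpDl ?sqr_ge0// exprn_gt0.
have c0 : 0 < c by rewrite sqrtr_gt0.
have c2 : c ^+ 2 = a ^+ 2 + b ^+ 2 by rewrite sqr_sqrtr// ltW.
rewrite !normal_pdfE ?gt_eqF ?divr_gt0 ?oner_neq0//.
rewrite /normal_peak /normal_fun !subr0 expr1n mul1r.
rewrite mulrACA [RHS]mulrACA -!expRD; congr (_ * expR _); last first.
  rewrite expr_div_n c2; field.
  by rewrite !gt_eqF// exprn_gt0.
have sqrE (s : R) : 0 < s ->
    Num.sqrt (s ^+ 2 * pi *+ 2) = s * Num.sqrt (pi *+ 2).
  by move=> s0; rewrite -mulrnAr sqrtrM ?sqr_ge0// sqrtr_sqr gtr0_norm.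
rewrite !sqrE ?divr_gt0//.
set q := Num.ExtraDef.sqrtr _.
have q0 : 0 < q by rewrite sqrtr_gt0 mulrn_wgt0// pi_gt0.
by field; rewrite !gt_eqF.
Qed.

Lemma std_normal_convolution (a b : R) (h : R -> R) : 0 <= a -> 0 <= b ->
  continuous h -> (forall x, 0 <= h x) ->
  (\int[gauss]_x \int[gauss]_y (h (a * x + b * y))%:E =
   \int[gauss]_z (h (Num.sqrt (a ^+ 2 + b ^+ 2) * z))%:E)%E.
Proof.
move=> a0 b0 ch h0.
(* The substitution below needs a positive standard deviation; for [b = 0] the inner integrand is
   constant in [y]. *)
have [b0'|/negP b0'] := eqVneq b 0.
  rewrite b0' expr0n addr0 sqrtr_sqr ger0_norm//.
  apply: eq_integral => x _; under eq_integral do rewrite mul0r addr0.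
  by rewrite integral_probability_cst.
have {b0' b0}b0 : 0 < b by rewrite lt_neqAle b0 eq_sym andbT; exact/negP.
have mh : measurable_fun [set: R] h by exact: continuous_measurable_fun.
under eq_integral do rewrite integral_normal_prob_affine//.
set c := Num.sqrt _.
have c0 : 0 < c by rewrite sqrtr_gt0 ltr_wpDl ?sqr_ge0// exprn_gt0.
have mpdf : measurable_fun [set: R * R]
    (fun p : R * R => normal_pdf (a * p.1) b p.2).
  rewrite (_ : (fun _ => _) =
      normal_pdf 0 b \o (fun p : R * R => p.2 - a * p.1)); last first.
    apply/funext => p /=; rewrite !normal_pdfE ?gt_eqF//.
    by rewrite /normal_fun subr0.
  apply: measurableT_comp; first exact: measurable_normal_pdf.
  by apply: measurable_funB => //; apply: measurable_funM.
have mhpdf : measurable_fun [set: R * R]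
    (fun p : R * R => h p.2 * normal_pdf (a * p.1) b p.2).
  by apply: measurable_funM => //; apply: measurableT_comp.
have mk : measurable_fun [set: R * R] (fun p : R * R =>
    (h p.2 * (normal_pdf 0 1 p.1 * normal_pdf (a * p.1) b p.2))%:E).
  apply/measurable_EFinP; under eq_fun do rewrite mulrCA.
  apply: measurable_funM => //; apply: measurableT_comp => //.
  exact: measurable_normal_pdf.
transitivity (\int[mu]_x \int[mu]_z
   (h z * (normal_pdf 0 1 x * normal_pdf (a * x) b z))%:E)%E.
  under eq_integral.
    move=> x _; rewrite ge0_integral_normal_prob//; first last.
      exact/measurable_EFinP.
    under eq_integral do rewrite -EFinM.
    over.
  have mhp x : measurable_fun [set: R]
      (fun z => (h z * normal_pdf (a * x) b z)%:E).
    apply/measurable_EFinP; apply: measurable_funM => //.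
    exact: measurable_normal_pdf.
  have hp0 x z : (0 <= (h z * normal_pdf (a * x) b z)%:E)%E.
    by rewrite lee_fin mulr_ge0// normal_pdf_ge0.
  rewrite ge0_integral_normal_prob//.
  - apply: eq_integral => x _.
    rewrite -ge0_integralZr//; last 2 first.
      exact: mhp.
      by rewrite lee_fin normal_pdf_ge0.
    by apply: eq_integral => z _; rewrite -EFinM; congr EFin; ring.
  - by apply: measurable_fun_integral => //; exact/measurable_EFinP.
  - by move=> x; apply: integral_ge0 => z _.
rewrite integral_exchange//; last first.
  by move=> x z; rewrite lee_fin !mulr_ge0// normal_pdf_ge0.
under [RHS]eq_integral do rewrite -[X in h X]add0r.
rewrite (integral_normal_prob_affine 0)// ge0_integral_normal_prob//; last first.
  exact/measurable_EFinP.
apply: eq_integral => z _.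
(* For fixed [z], only the conditional density depends on [x], and it integrates to [1]. *)
under eq_integral do rewrite normal_pdf_convolution// mulrA EFinM.
rewrite ge0_integralZl//=.
- by rewrite integral_normal_pdf mule1 -EFinM.
- by apply/measurable_EFinP; exact: measurable_normal_pdf.
- by move=> x _; rewrite lee_fin normal_pdf_ge0.
- by rewrite lee_fin mulr_ge0// normal_pdf_ge0.
Qed.
End conv.

(** * Symmetry and moments of the standard normal law *)

Section moments.
Context {R : realType}.
Local Notation mu := (@lebesgue_measure R).
Local Notation gauss := (@std_normal R).
Local Notation phi := (@normal_pdf R 0 1).

Lemma std_normal_symmetric (f : R -> \bar R) :
  measurable_fun [set: R] f -> (forall x, 0 <= f x)%E ->
  (\int[gauss]_z f (- z)%R = \int[gauss]_z f z)%E.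
Proof.
move=> mf f0.
have mN : measurable_fun [set: R] (fun z : R => - z) by exact: oppr_measurable.
rewrite !ge0_integral_normal_prob//; last first.
  by apply: (measurableT_comp mf).
have mg : measurable_fun [set: R] (fun z => f z * (phi z)%:E)%E.
  by apply: emeasurable_funM => //; apply/measurable_EFinP; exact: measurable_normal_pdf.
transitivity (\int[pushforward mu (-%R : _ -> measurableTypeR R)]_z
    (f z * (phi z)%:E))%E; last first.
  by apply: eq_measure_integral => A mA _; exact: lebesgue_measureN.
rewrite ge0_integral_pushforward; last 4 first.
- exact: oppr_measurable.
- exact: measurableT.
- exact: mg.
- by move=> x _; rewrite mule_ge0// lee_fin normal_pdf_ge0.
rewrite preimage_setT; apply: eq_integral => z _ /=; congr (_ * _%:E)%E.
by rewrite !normal_pdfE ?oner_neq0// /normal_fun !subr0 sqrrN.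
Qed.

Lemma is_derive_expR_comp (f : R -> R) (z df : R) :
  is_derive z 1 f df -> is_derive z 1 (fun z => expR (f z)) (df * expR (f z)).
Proof.
move=> df_z; rewrite mulrC.
exact: (@is_derive1_comp R expR f z _ _ (is_derive_expR _) df_z).
Qed.
Lemma is_derive_gauss (c z : R) :
  is_derive z 1 (fun z => c * expR (- (z - 0) ^+ 2 / (1 ^+ 2 *+ 2)))
    (- z * (c * expR (- (z - 0) ^+ 2 / (1 ^+ 2 *+ 2)))).
Proof.
have sq : is_derive z 1 (fun z : R => - (z - 0) ^+ 2 / (1 ^+ 2 *+ 2)) (- z).
  under eq_fun do rewrite subr0.
  apply: is_derive_eq; rewrite !scaler0 add0r /GRing.scale/= !mulr1.
  by rewrite expr1n -mulr2n mulrN -(mulr_natl z) mulKf.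
have := @is_deriveZ R R R _ c z 1 _ (is_derive_expR_comp sq).
by rewrite /GRing.scale/= mulrCA.
Qed.
Lemma is_derive_phi (z : R) : is_derive z 1 phi (- z * phi z).
Proof. by rewrite normal_pdfE ?oner_neq0//; exact: is_derive_gauss. Qed.

Lemma cvg_idM_phi : (x * phi x) @[x --> +oo] --> (0 : R).
Proof.
apply: (@squeeze_cvgr _ _ _ _ (cst 0) (fun x => normal_peak 1 * expR (- x))).
- near=> x.
  (* From [4] on, [x - x ^+ 2 / 2 <= - x]; with [x <= expR x] this bounds [x * phi x] by a multiple
     of [expR (- x)]. *)
  have x4 : 4 <= x by near: x; exact: nbhs_pinfty_ge.
  have x0 : 0 <= x by rewrite (le_trans _ x4).
  rewrite mulr_ge0 ?normal_pdf_ge0//=.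
  rewrite normal_pdfE ?oner_neq0// /normal_fun subr0 expr1n mulrCA.
  rewrite ler_wpM2l ?normal_peak_ge0//.
  apply: (@le_trans _ _ (expR x * expR (- x ^+ 2 / 2))).
    by rewrite ler_wpM2r ?expR_ge0// (le_trans _ (expR_ge1Dx x))// lerDr.
  rewrite -expRD ler_expR -subr_ge0.
  rewrite [leRHS](_ : _ = x * (x - 4) / 2); last by field.
  by rewrite divr_ge0// mulr_ge0 ?subr_ge0.
- exact: cvg_cst.
- rewrite -[X in _ --> X](mulr0 (normal_peak (1 : R))).
  by apply: cvgM; [exact: cvg_cst|exact: cvgr_expR].
Unshelve. all: by end_near.
Qed.

Lemma is_derive_idM_phi (z : R) :
  is_derive z 1 (fun x => x * phi x) ((1 - z ^+ 2) * phi z).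
Proof.
have := @is_deriveM R R id phi z 1 _ _ (is_derive_id _ _) (is_derive_phi z).
rewrite /GRing.scale/= => /is_derive_eq; apply; ring.
Qed.

Lemma continuous_idM_phi : continuous (fun x : R => x * phi x).
Proof.
move=> x; apply: cvgM; first exact: cvg_id.
by apply: continuous_normal_pdf; rewrite oner_neq0.
Qed.

Let continuous_sqrM_phi : continuous (fun x : R => (1 - x ^+ 2) * phi x).
Proof.
move=> x; apply: cvgM; last by apply: continuous_normal_pdf; rewrite oner_neq0.
by apply: cvgB; [exact: cvg_cst|exact: exprn_continuous].
Qed.

(** The fundamental theorem of calculus for [x * phi x] on [[0, 1]], written additively so that
    every integrand is nonnegative. *)
Let integral_phi01 : (\int[mu]_(x in `[0%R, 1%R]) (phi x)%:E =
  \int[mu]_(x in `[0%R, 1%R]) (x ^+ 2 * phi x)%:E + (phi 1)%:E)%E.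
Proof.
have /= := @continuous_FTC2 R (fun x => (1 - x ^+ 2) * phi x)
  (fun x => x * phi x) 0 1 ltr01.
rewrite mul0r mul1r sube0 => <-; first last.
- by move=> x _; rewrite derive1E; have [] := is_derive_idM_phi x.
- split.
  + by move=> x _; have [] := is_derive_idM_phi x.
  + exact/cvg_at_right_filter/continuous_idM_phi.
  + exact/cvg_at_left_filter/continuous_idM_phi.
- exact/continuous_subspaceT/continuous_sqrM_phi.
rewrite -ge0_integralD//=; last 4 first.
- by move=> x _; rewrite lee_fin mulr_ge0 ?sqr_ge0 ?normal_pdf_ge0.
- apply/measurable_EFinP/measurable_funTS; apply: measurable_funM => //.
  exact: measurable_normal_pdf.
- move=> x /=; rewrite in_itv/= => /andP[x0 x1].
  by rewrite lee_fin mulr_ge0 ?normal_pdf_ge0// subr_ge0 expr_le1.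
- apply/measurable_EFinP/measurable_funTS.
  by apply: continuous_measurable_fun; exact: continuous_sqrM_phi.
by apply: eq_integral => x _; rewrite -EFinD; congr EFin; ring.
Qed.

Let integral_sqr_phi1y : (\int[mu]_(x in `[1%R, +oo[) (x ^+ 2 * phi x)%:E =
  \int[mu]_(x in `[1%R, +oo[) (phi x)%:E + (phi 1)%:E)%E.
Proof.
have dF (x : R) : is_derive x 1 (fun x => - (x * phi x)) (- ((1 - x ^+ 2) * phi x)).
  exact: is_deriveN (is_derive_idM_phi x).
have cF : continuous (fun x : R => - (x * phi x)).
  by move=> x; apply: cvgN; exact: continuous_idM_phi.
have cf : continuous (fun x : R => - ((1 - x ^+ 2) * phi x)).
  by move=> x; apply: cvgN; exact: continuous_sqrM_phi.
have /= := @ge0_continuous_FTC2y R (fun x => - ((1 - x ^+ 2) * phi x))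
  (fun x => - (x * phi x)) 1 0.
have f0 (x : R) : 1 <= x -> 0 <= - ((1 - x ^+ 2) * phi x).
  move=> x1; rewrite -mulNr mulr_ge0 ?normal_pdf_ge0// opprB subr_ge0.
  by rewrite expr_ge1// (le_trans ler01).
rewrite mul1r opprK add0e => <-//; first last.
- by move=> x _; rewrite derive1E; have [] := dF x.
- by apply: cvg_at_right_filter; rewrite -[X in - X]mul1r; exact: cF.
- rewrite -[X in _ --> X]oppr0; apply: cvgN; exact: cvg_idM_phi.
- exact/continuous_subspaceT/cf.
rewrite -ge0_integralD//=; last 4 first.
- by move=> x _; rewrite lee_fin normal_pdf_ge0.
- by apply/measurable_EFinP/measurable_funTS; exact: measurable_normal_pdf.
- by move=> x /=; rewrite in_itv/= andbT => x1; rewrite lee_fin f0.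
- apply/measurable_EFinP/measurable_funTS.
  by apply: continuous_measurable_fun; exact: cf.
by apply: eq_integral => x _; rewrite -EFinD; congr EFin; ring.
Qed.

(* [x * phi x] is a primitive of [(1 - x ^+ 2) * phi x]; cutting at [1] keeps the
   sign of the integrand constant on each piece. *)
Lemma std_normal_second_moment : (\int[gauss]_z (z ^+ 2)%:E = 1)%E.
Proof.
have cphi : continuous phi by apply: continuous_normal_pdf; rewrite oner_neq0.
have csq : continuous (fun x : R => x ^+ 2 * phi x).
  by move=> x; apply: cvgM; [exact: exprn_continuous|exact: cphi].
have phiN (x : R) : phi (- x) = phi x.
  by rewrite !normal_pdfE ?oner_neq0// /normal_fun !subr0 sqrrN.
have sq0 (x : R) : 0 <= x ^+ 2 * phi x by rewrite mulr_ge0 ?sqr_ge0 ?normal_pdf_ge0.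
rewrite ge0_integral_normal_prob; last 2 first.
- exact/measurable_EFinP.
- by move=> x; rewrite lee_fin sqr_ge0.
rewrite -(integral_normal_pdf 0 1).
under eq_integral do rewrite -EFinM.
rewrite ge0_symfun_integralT//; last by move=> x; rewrite /= sqrrN phiN.
rewrite [RHS]ge0_symfun_integralT//; last 2 first.
- exact: normal_pdf_ge0.
- by move=> x; rewrite /= phiN.
congr (_ * _)%E.
have -> : [set x : R | 0 <= x] = `[0, 1] `|` `]1, +oo[.
  apply/seteqP; split=> x /=; rewrite !in_itv/= andbT.
    by move=> ->/=; case: (leP x 1) => [|]; [left|right].
  by move=> [/andP[]//|/ltW]; exact: le_trans.
have dis : [disjoint `[0%R, 1%R] & `]1%R, +oo[ : set R].
  apply/disj_setPS => x [/=]; rewrite !in_itv/= andbT => /andP[_ x1].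
  by rewrite ltNge x1.
have mphi : measurable_fun [set: R] (fun x => (phi x)%:E).
  by apply/measurable_EFinP; exact: measurable_normal_pdf.
have msq : measurable_fun [set: R] (fun x => (x ^+ 2 * phi x)%:E).
  by apply/measurable_EFinP; exact: continuous_measurable_fun.
rewrite ge0_integral_setU//; last 2 first.
- exact: measurable_funTS.
- by move=> x _; rewrite lee_fin.
rewrite [RHS]ge0_integral_setU//; last 2 first.
- exact: measurable_funTS.
- by move=> x _; rewrite lee_fin normal_pdf_ge0.
rewrite !integral_itv_obnd_cbnd; last 2 first.
- exact: measurable_funTS.
- exact: measurable_funTS.
(* The boundary term [phi 1] lost on [[0, 1]] is regained on [[1, +oo[]. *)
by rewrite integral_sqr_phi1y integral_phi01 addeA addeAC.
Qed.

Lemma std_normal_third_moment : (\int[gauss]_z (`|z| ^+ 3)%:E < +oo)%E.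
Proof.
have m3 : measurable_fun [set: R] (fun z : R => `|z| ^+ 3).
  by apply: measurable_funX; exact: normr_measurable.
rewrite ge0_integral_normal_prob; last 2 first.
- exact/measurable_EFinP.
- by move=> x; rewrite lee_fin exprn_ge0.
(* domination by the density of standard deviation [2] *)
pose C : R := 30 * (normal_peak 1 / normal_peak 2).
apply: (@le_lt_trans _ _ (\int[mu]_z (C%:E * (normal_pdf 0 2 z)%:E))%E).
  apply: ge0_le_integral => //.
  - by move=> x _; rewrite lee_fin mulr_ge0 ?exprn_ge0 ?normal_pdf_ge0.
  - apply/measurable_EFinP; apply: measurable_funM => //.
    exact: measurable_normal_pdf.
  - apply/measurable_EFinP; apply: measurable_funM => //.
    exact: measurable_normal_pdf.
  - move=> z _; rewrite lee_fin !normal_pdfE ?oner_neq0//.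
    have pk2 : normal_peak (2 : R) != 0 by rewrite gt_eqF// normal_peak_gt0.
    rewrite mulrCA [leRHS](_ : _ =
      normal_peak 1 * (30 * normal_fun 0 2 z)); last by rewrite /C; field.
    rewrite ler_wpM2l ?normal_peak_ge0// /normal_fun subr0 expr1n.
    have -> : - z ^+ 2 / (1 *+ 2) =
        - (3 / 8 * z ^+ 2) + - z ^+ 2 / (2 ^+ 2 *+ 2) by field.
    rewrite expRD mulrA ler_wpM2r ?expR_ge0// expRN ler_pdivrMr ?expR_gt0//.
    (* [expR u] is the quotient of the two Gaussian exponentials. It dominates [(1 + u / 2) ^+ 2],
       while [|z|^3 <= 1 + z^4 = 1 + 64 / 9 * u ^+ 2]; the constant [30] suffices because
       [30 / 4 >= 64 / 9]. *)
    set u := 3 / 8 * z ^+ 2.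
    have u0 : 0 <= u by rewrite mulr_ge0 ?sqr_ge0.
    have eu : (1 + u / 2) ^+ 2 <= expR u.
      rewrite [in leRHS](_ : u = 2 * (u / 2)); last by field.
      rewrite expRM_natl lerXn2r ?nnegrE ?expR_ge0 ?expR_ge1Dx//.
      by rewrite addr_ge0// divr_ge0.
    have z2 : `|z| ^+ 2 = 8 / 3 * u by rewrite real_normK ?num_real// /u; field.
    apply: (@le_trans _ _ (30 * (1 + u / 2) ^+ 2)); last by rewrite ler_pM2l.
    have z0 := normr_ge0 z.
    have : `|z| ^+ 3 <= 1 + (`|z| ^+ 2) ^+ 2.
      by case: (leP `|z| 1) => z1; nra.
    rewrite z2; nra.
rewrite ge0_integralZl//.
- by rewrite integral_normal_pdf mule1 ltry.
- by apply/measurable_EFinP; exact: measurable_normal_pdf.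
- by move=> x _; rewrite lee_fin normal_pdf_ge0.
- by rewrite lee_fin !mulr_ge0 ?invr_ge0 ?normal_peak_ge0.
Qed.
End moments.

(** * Replacing one summand *)

Section positive_part.
Context {R : realType}.
Implicit Types u y : R.

Lemma pos_part_ge0 u : 0 <= pos_part u. Proof. by rewrite le_max lexx. Qed.

Lemma ger0_pos_part u : 0 <= u -> pos_part u = u.
Proof. by move=> u0; apply/max_r. Qed.

Lemma ler0_pos_part u : u <= 0 -> pos_part u = 0.
Proof. by move=> u0; apply/max_l. Qed.

Lemma continuous_pos_part : continuous (@pos_part R).
Proof.
move=> x; apply: (@continuous_max R R (cst 0) id x); first exact: cvg_cst.
exact: cvg_id.
Qed.

Lemma continuous_pos_part3 : continuous (fun u => pos_part u ^+ 3).
Proof.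
move=> u; apply: (@continuous_comp _ _ _ (@pos_part R) (fun x => x ^+ 3)).
  exact: continuous_pos_part.
exact: exprn_continuous.
Qed.

Lemma measurable_pos_part3 :
  measurable_fun [set: R] (fun u : R => pos_part u ^+ 3).
Proof. by apply: continuous_measurable_fun; exact: continuous_pos_part3. Qed.

Lemma pos_part3_ge0 u : 0 <= pos_part u ^+ 3.
Proof. by rewrite exprn_ge0// pos_part_ge0. Qed.

(** Second-order Taylor expansion of [f u = u_+^3]. Since [0 <= f''' <= 6], the remainder is at most
    [y ^+ 3] for [y >= 0] and is nonpositive for [y <= 0], so only the positive part of [y] is
    charged. *)
Lemma pos_part3D_le u y : pos_part (u + y) ^+ 3 <=
  pos_part u ^+ 3 + 3 * pos_part u ^+ 2 * y + 3 * pos_part u * y ^+ 2 +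
  pos_part y ^+ 3.
Proof.
case: (leP u 0) => u0.
  rewrite (ler0_pos_part u0) !expr0n/= !(mulr0, mul0r, add0r).
  rewrite lerXn2r ?nnegrE ?pos_part_ge0// /pos_part ge_max le_max lexx/=.
  by case: (leP y 0) => y0; lra.
rewrite (ger0_pos_part (ltW u0)).
case: (leP y 0) => y0; case: (leP (u + y) 0) => uy0.
- rewrite (ler0_pos_part uy0) (ler0_pos_part y0) expr0n/=.
  rewrite [leRHS](_ : _ = u * ((u + 3 / 2 * y) ^+ 2 + 3 / 4 * y ^+ 2)).
    apply: mulr_ge0; first exact: ltW.
    by rewrite addr_ge0 ?sqr_ge0// mulr_ge0 ?sqr_ge0// divr_ge0.
  by field.
- rewrite (ger0_pos_part (ltW uy0)) (ler0_pos_part y0) -subr_ge0.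
  rewrite [leRHS](_ : _ = (- y) ^+ 3); last by ring.
  by rewrite exprn_ge0// oppr_ge0.
- by lra.
- rewrite (ger0_pos_part (ltW uy0)) (ger0_pos_part (ltW y0)) -subr_ge0.
  by rewrite [leRHS](_ : _ = 0); last by ring.
Qed.

(** Convexity of [f'' u = 6 * u_+] makes the symmetric second difference of [u_+^3] at least
    [f'' u * y ^+ 2]. For [u > 0] and [y >= 0] there is equality when [y <= u], and a surplus
    [(y - u) ^+ 3] when [y > u]. *)
Lemma pos_part3_second_difference u y :
  2 * pos_part u ^+ 3 + 6 * pos_part u * y ^+ 2 <=
  pos_part (u + y) ^+ 3 + pos_part (u - y) ^+ 3.
Proof.
wlog y0 : y / 0 <= y.
  move=> th; case: (leP 0 y) => [|y0]; first exact: th.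
  have := th (- y); rewrite sqrrN opprK (addrC (pos_part (u - y) ^+ 3)).
  by apply; rewrite oppr_ge0 ltW.
case: (leP u 0) => u0.
  rewrite (ler0_pos_part u0) expr0n/= !(mulr0, mul0r, addr0).
  by rewrite addr_ge0// pos_part3_ge0.
rewrite (ger0_pos_part (ltW u0)) (ger0_pos_part (addr_ge0 (ltW u0) y0)).
case: (leP y u) => yu.
  rewrite ger0_pos_part ?subr_ge0// -subr_ge0.
  by rewrite [leRHS](_ : _ = 0); last by ring.
have uy : u - y <= 0 by rewrite subr_le0 ltW.
rewrite (ler0_pos_part uy) expr0n/= addr0 -subr_ge0.
rewrite [leRHS](_ : _ = (y - u) ^+ 3); last by ring.
by rewrite exprn_ge0// subr_ge0 ltW.
Qed.

Lemma normr3_pos_part u : `|u| ^+ 3 = pos_part u ^+ 3 + pos_part (- u) ^+ 3.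
Proof.
case: (leP 0 u) => u0.
  by rewrite (ger0_pos_part u0) (@ler0_pos_part (- u)) ?oppr_le0// expr0n addr0 ger0_norm.
by rewrite (ler0_pos_part (ltW u0)) expr0n add0r ltr0_norm// ger0_pos_part// oppr_ge0 ltW.
Qed.

End positive_part.

Section one_step.
Context {R : realType} d (T : measurableType d) (P : probability T R).
Local Notation gauss := (@std_normal R).

Lemma integrable_of_sqr (X : {RV P >-> R}) :
  (\int[P]_w (X w ^+ 2)%:E < +oo)%E -> P.-integrable [set: T] (EFin \o X).
Proof.
move=> X2; apply/integrableP; split; first exact/measurable_EFinP.
have mX2 : measurable_fun [set: T] (fun w => (X w ^+ 2)%:E).
  by apply/measurable_EFinP; exact: measurable_funX.
apply: (@le_lt_trans _ _ (\int[P]_w (1%:E + (X w ^+ 2)%:E))%E).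
  apply: ge0_le_integral => //.
  - by apply/measurable_EFinP; apply: measurableT_comp.
  - by apply: emeasurable_funD.
  - move=> w _; rewrite /= lee_fin -real_normK ?num_real//.
    have := normr_ge0 (X w); nra.
rewrite ge0_integralD//; last by move=> w _; rewrite lee_fin sqr_ge0.
by rewrite integral_probability_cst lte_add_pinfty// ltry.
Qed.

(** The Taylor bound is integrated term by term. The linear term may be dropped because its
    coefficient [3 * pos_part u ^+ 2] is nonnegative and the mean is nonpositive. *)
Lemma integral_pos_part3D_le (X : {RV P >-> R}) (s u : R) :
  ('E_P[X] <= 0)%E -> (\int[P]_w (X w ^+ 2)%:E = (s ^+ 2)%:E)%E ->
  (\int[P]_w (pos_part (u + X w) ^+ 3)%:E <=
   (pos_part u ^+ 3 + 3 * pos_part u * s ^+ 2)%:E +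
   \int[P]_w (pos_part (X w) ^+ 3)%:E)%E.
Proof.
move=> X1 X2.
have mX : measurable_fun [set: T] X by [].
have m3 : measurable_fun [set: T] (fun w => (pos_part (X w) ^+ 3)%:E).
  by apply/measurable_EFinP; exact: (measurableT_comp measurable_pos_part3).
have p30 w : (0 <= (pos_part (X w) ^+ 3)%:E)%E by rewrite lee_fin pos_part3_ge0.
(* An infinite third moment makes the right side [+oo]; otherwise every term is integrable and the
   integral is linear. *)
have [X3|] := ltP (\int[P]_w (pos_part (X w) ^+ 3)%:E)%E +oo%E; last first.
  by rewrite leye_eq => /eqP ->; rewrite addey// leey.
have iX : P.-integrable [set: T] (EFin \o X).
  by apply: integrable_of_sqr; rewrite X2 ltry.
have i2 : P.-integrable [set: T] (fun w => (X w ^+ 2)%:E).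
  apply/integrableP; split; first by apply/measurable_EFinP; exact: measurable_funX.
  under eq_integral do rewrite gee0_abs ?lee_fin ?sqr_ge0//.
  by rewrite X2 ltry.
have i3 : P.-integrable [set: T] (fun w => (pos_part (X w) ^+ 3)%:E).
  apply/integrableP; split => //.
  by under eq_integral do rewrite gee0_abs//.
have b0 : 0 <= 3 * pos_part u ^+ 2 by rewrite mulr_ge0 ?sqr_ge0.
apply: (@le_trans _ _ (\int[P]_w ((pos_part u ^+ 3)%:E +
   ((3 * pos_part u ^+ 2)%:E * (X w)%:E +
    ((3 * pos_part u)%:E * (X w ^+ 2)%:E + (pos_part (X w) ^+ 3)%:E))))%E).
  apply: ge0_le_integral => //.
  - by move=> w _; rewrite lee_fin pos_part3_ge0.
  - apply/measurable_EFinP; apply: (measurableT_comp measurable_pos_part3).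
    exact: measurable_funD.
  - apply: emeasurable_funD => //; apply: emeasurable_funD.
      by apply/measurable_EFinP; apply: measurable_funM.
    apply: emeasurable_funD => //.
    by apply/measurable_EFinP; apply: measurable_funM => //; exact: measurable_funX.
  - move=> w _; rewrite -!EFinM -!EFinD lee_fin !addrA.
    exact: pos_part3D_le.
have iZ2 := integrableZl measurableT (3 * pos_part u) i2.
have iZ1 := integrableZl measurableT (3 * pos_part u ^+ 2) iX.
rewrite integralD//; last first.
- by apply: integrableD => //; exact: integrableD.
- exact: finite_measure_integrable_cst.
rewrite integralD//; last exact: integrableD.
rewrite integralD// integralZl// integralZl// X2 integral_probability_cst.
rewrite EFinD -addeA leeD2l// addeA leeD2r//.
rewrite -[leRHS]add0e EFinM leeD2r//.
by rewrite mule_ge0_le0// ?lee_fin// -expectation_def.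
Qed.

(** By symmetry of the normal law the values at [z] and [- z] may be averaged; the second-difference
    bound then applies pointwise, and the second moment of [z] is [1]. *)
Lemma integral_pos_part3_std_normal_ge (s u : R) :
  ((pos_part u ^+ 3 + 3 * pos_part u * s ^+ 2)%:E <=
   \int[gauss]_z (pos_part (u + s * z) ^+ 3)%:E)%E.
Proof.
have p30 (v : R) : (0 <= (pos_part v ^+ 3)%:E)%E by rewrite lee_fin pos_part3_ge0.
have m3 (t : R) : measurable_fun [set: R] (fun z : R => (pos_part (u + t * z) ^+ 3)%:E).
  apply/measurable_EFinP; apply: (measurableT_comp measurable_pos_part3).
  by apply: measurable_funD => //; exact: measurable_funM.
have m3N : measurable_fun [set: R] (fun z : R => (pos_part (u + s * - z) ^+ 3)%:E).
  by under eq_fun do rewrite mulrN -mulNr; exact: m3.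
have msq : measurable_fun [set: R] (fun z : R => (z ^+ 2)%:E).
  by apply/measurable_EFinP; exact: measurable_funX.
have c0 : 0 <= 6 * pos_part u * s ^+ 2.
  by rewrite mulr_ge0 ?sqr_ge0// mulr_ge0 ?pos_part_ge0.
have sym := std_normal_symmetric (m3 s) (fun z => p30 _).
(* Doubling provides one copy of the integral for [z] and one for [- z]. *)
have two : (2%:E * (pos_part u ^+ 3 + 3 * pos_part u * s ^+ 2)%:E <=
   2%:E * \int[gauss]_z (pos_part (u + s * z) ^+ 3)%:E)%E.
  rewrite [leRHS]mule_natl mule2n -{1}sym -ge0_integralD//; last exact: (m3 s).
  apply: (@le_trans _ _ (\int[gauss]_z ((2 * pos_part u ^+ 3)%:E +
     (6 * pos_part u * s ^+ 2)%:E * (z ^+ 2)%:E))%E).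
    rewrite ge0_integralD//; last 3 first.
    - by move=> z _; rewrite lee_fin mulr_ge0 ?exprn_ge0 ?pos_part_ge0.
    - by move=> z _; rewrite -EFinM lee_fin (mulr_ge0 c0 (sqr_ge0 _)).
    - by apply/measurable_EFinP; apply: measurable_funM => //; exact: measurable_funX.
    rewrite integral_probability_cst ge0_integralZl//; last first.
      by move=> z _; rewrite lee_fin sqr_ge0.
    rewrite std_normal_second_moment mule1 -EFinD -EFinM lee_fin; lra.
  apply: ge0_le_integral => //.
  - move=> z _; rewrite -EFinM -EFinD lee_fin addr_ge0//.
      by rewrite mulr_ge0 ?exprn_ge0 ?pos_part_ge0.
    exact: (mulr_ge0 c0 (sqr_ge0 _)).
  - apply: emeasurable_funD => //.
    by apply/measurable_EFinP; apply: measurable_funM => //; exact: measurable_funX.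
  - by apply: emeasurable_funD; [exact: m3N|exact: (m3 s)].
  - move=> z _; rewrite -EFinM -!EFinD lee_fin mulrN [leRHS]addrC.
    rewrite -[_ * _ * z ^+ 2]mulrA -exprMn.
    exact: pos_part3_second_difference.
by move: two; rewrite lee_pmul2l.
Qed.

End one_step.

(** * Independence and partial sums *)

Section joint_law.
Context {R : realType} d (T : measurableType d) (P : probability T R).

(* [E] will be an event of the remaining variables.  After normalisation by
   [P E], this is uniqueness of the product measure. *)
Lemma joint_law_on_event (X Y : {RV P >-> R}) (E : set T) (mE : measurable E) :
  (forall A B : set R, measurable A -> measurable B ->
    P (X @^-1` A `&` (Y @^-1` B `&` E)) = P (X @^-1` A) * P (Y @^-1` B) * P E)%E ->
  forall D : set (R * R), measurable D ->
    P ((fun w => (X w, Y w)) @^-1` D `&` E) =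
    ((distribution P X \x distribution P Y) D * P E)%E.
Proof.
move=> XYE D mD.
pose XY w := (X w, Y w).
have mXY : measurable_fun [set: T] XY by exact: measurable_fun_pair.
have mXYD : measurable (XY @^-1` D).
  by rewrite -[X in measurable X]setTI; exact: mXY.
have [PE0|PE0] := eqVneq (P E) 0%E.
  rewrite PE0 mule0; apply/eqP; rewrite eq_le measure_ge0 andbT -PE0.
  by rewrite le_measure ?inE//; exact: measurableI.
have PEfin : P E \is a fin_num by exact: fin_num_measure.
have PEgt0 : (0 < fine (P E))%R.
  by rewrite fine_gt0// lt0e PE0 measure_ge0/= ltey_eq PEfin.
have Vge0 : (0 <= (fine (P E))^-1)%R by rewrite invr_ge0 ltW.
pose XY' : {mfun T >-> (R * R)%type} := HB.pack XY (isMeasurableFun.Build _ _ _ _ _ mXY).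
rewrite (@product_measure_unique _ _ _ _ _ _ _
  (mscale (NngNum Vge0) (pushforward (mrestr P mE) XY')))//=.
  rewrite /mscale/= /pushforward/= /mrestr -[P E in RHS]fineK// muleC muleA.
  by rewrite -EFinM divff ?gt_eqF// mul1e.
move=> A B mA mB; rewrite /mscale/= /pushforward/= /mrestr.
rewrite (_ : _ `&` E = X @^-1` A `&` (Y @^-1` B `&` E)); last by rewrite setIA.
rewrite XYE// -[P E]fineK// muleC -muleA -EFinM divff ?gt_eqF// mule1//.
Qed.

End joint_law.

Section partial_sums.
Context {R : realType} d (T : measurableType d) (P : probability T R).
Variables (n : nat) (X : 'I_n -> {RV P >-> R}).

(** Filtering the full index type, instead of summing over ['I_k], keeps the family [X] fixed during
    inductions on [k]. *)
Definition partial_sum (k : nat) (w : T) : R := \sum_(i < n | (i < k)%N) X i w.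

Let measurable_partial_sum k : measurable_fun [set: T] (partial_sum k).
Proof.
rewrite /partial_sum; under eq_fun do rewrite big_mkcond/=.
by apply: measurable_sum => i; case: (i < k)%N.
Qed.

HB.instance Definition _ k :=
  isMeasurableFun.Build d _ T R (partial_sum k) (measurable_partial_sum k).

Lemma partial_sum0 w : partial_sum 0 w = 0.
Proof. by rewrite /partial_sum big_pred0. Qed.

Lemma partial_sumS (k : 'I_n) w : partial_sum k.+1 w = partial_sum k w + X k w.
Proof.
rewrite /partial_sum (bigD1 k)//= addrC; congr (_ + _).
by apply: eq_bigl => i; rewrite ltnS andbC ltn_neqAle.
Qed.

Hypothesis indX : independent_RVs X.

Let joint_event (J : {set 'I_n}) (B : 'I_n -> set R) : set T :=
  \bigcap_(i in [set` J]) (X i @^-1` B i).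

Let measurable_joint_event (J : {set 'I_n}) (B : 'I_n -> set R) :
  (forall i, i \in J -> measurable (B i)) -> measurable (joint_event J B).
Proof.
move=> mB; apply: fin_bigcap_measurable => // i /= iJ.
by rewrite -[X in measurable X]setTI; apply: measurable_funP => //; exact: mB.
Qed.

Let joint_eventU1 (J : {set 'I_n}) (B : 'I_n -> set R) i C : i \notin J ->
  joint_event (i |: J)%SET (fun j => if j == i then C else B j) =
  X i @^-1` C `&` joint_event J B.
Proof.
move=> iJ; apply/seteqP; split=> w /=.
  move=> h; split; first by have := h i; rewrite /= !inE eqxx; apply.
  move=> j /= jJ; have := h j; rewrite /= !inE jJ orbT.
  by case: eqVneq => [ji|_]; [rewrite -ji jJ in iJ|apply].
move=> [wi wJ] j /=; rewrite !inE; case: eqVneq => [->|_]//= jJ.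
exact: wJ.
Qed.

(** Induction on [k]. Adjoining the index [k] to [J] in the induction hypothesis gives the product
    rule on rectangles for [partial_sum k] and the next variable, in presence of the later events;
    [joint_law_on_event] extends it to the preimage of [C] under addition. *)
Lemma partial_sum_independent (k : nat) (J : {set 'I_n}) (B : 'I_n -> set R)
    (C : set R) : (k <= n)%N -> (forall i, i \in J -> (k <= i)%N) ->
  (forall i, i \in J -> measurable (B i)) -> measurable C ->
  P (partial_sum k @^-1` C `&` joint_event J B) =
  (P (partial_sum k @^-1` C) * \prod_(i in J) P (X i @^-1` B i))%E.
Proof.
elim: k J B C => [|k IH] J B C kn kJ mB mC.
  have -> : partial_sum 0 @^-1` C = [set _ | C 0].
    by apply/funext => w; rewrite /preimage /mkset /= partial_sum0.
  have [C0|C0] := pselect (C 0).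
    rewrite (_ : [set _ | C 0] = setT); last by apply/seteqP; split.
    by rewrite setTI probability_setT mul1e; exact: indX.
  rewrite (_ : [set _ | C 0] = set0); last by apply/seteqP; split.
  by rewrite set0I measure0 mul0e.
pose i0 := Ordinal kn.
have pairE (J' : {set 'I_n}) (B' : 'I_n -> set R) (D : set (R * R)) :
    (forall i, i \in J' -> (k < i)%N) ->
    (forall i, i \in J' -> measurable (B' i)) -> measurable D ->
    P ((fun w => (partial_sum k w, X i0 w)) @^-1` D `&` joint_event J' B') =
    ((distribution P (partial_sum k) \x distribution P (X i0)) D *
     P (joint_event J' B'))%E.
  move=> kJ' mB' mD.
  apply: joint_law_on_event => //; first exact: measurable_joint_event.
  move=> A A' mA mA'.
  have i0J : i0 \notin J' by apply/negP => /kJ'; rewrite ltnn.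
  rewrite -joint_eventU1// IH//; last 3 first.
  - exact: ltnW.
  - by move=> i; rewrite !inE => /predU1P[->//|/kJ'/ltnW].
  - by move=> i; rewrite !inE; case: eqVneq => //= _; exact: mB'.
  rewrite -muleA; congr (_ * _)%E.
  rewrite big_setU1//= eqxx; congr (_ * _)%E.
  rewrite (indX _)//; apply: eq_bigr => i iJ.
  by case: eqVneq => // ii0; rewrite -ii0 iJ in i0J.
have mD : measurable [set p : R * R | C (p.1 + p.2)].
  have mS : measurable_fun [set: R * R] (fun p : R * R => p.1 + p.2).
    exact: measurable_funD.
  by rewrite -[X in measurable X]setTI; exact: mS.
have sumE : partial_sum k.+1 @^-1` C =
    (fun w => (partial_sum k w, X i0 w)) @^-1` [set p : R * R | C (p.1 + p.2)].
  by apply/funext => w; rewrite /preimage/mkset/= (partial_sumS i0).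
rewrite sumE pairE// -[in RHS](indX mB); congr (_ * _)%E.
(* With the empty family, [pairE] computes the law of the new partial sum itself, which identifies
   the remaining factor. *)
have E0 : joint_event finset.set0 B = setT.
  by rewrite /joint_event; apply/seteqP; split=> // w _ i; rewrite /= inE.
have := @pairE finset.set0 B _ _ _ mD.
rewrite E0 setIT probability_setT mule1 => -> // i; rewrite inE//.
Qed.

(** The joint law is a product, so Tonelli applies. The independent copy of [X k] is a second
    integration variable on the same space, so the space need not be enlarged. *)
Lemma integral_partial_sum_pair (k : 'I_n) (h : R -> R -> \bar R) :
  measurable_fun [set: R * R] (fun p => h p.1 p.2) ->
  (forall s y, 0 <= h s y)%E ->
  (\int[P]_w h (partial_sum k w) (X k w) =
   \int[P]_w \int[P]_w' h (partial_sum k w) (X k w'))%E.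
Proof.
move=> mh h0.
have mXY : measurable_fun [set: T] (fun w => (partial_sum k w, X k w)).
  exact: measurable_fun_pair.
transitivity (\int[pushforward P (fun w => (partial_sum k w, X k w))]_p
    h p.1 p.2)%E.
  by rewrite ge0_integral_pushforward.
transitivity (\int[distribution P (partial_sum k) \x distribution P (X k)]_p
    h p.1 p.2)%E.
  apply: eq_measure_integral => D mD _.
  have := @joint_law_on_event _ _ _ P (partial_sum k) (X k) setT measurableT.
  rewrite probability_setT => /(_ _ D mD); rewrite setIT mule1; apply.
  move=> A B mA mB; rewrite setIT mule1.
  have := @partial_sum_independent k [set k]%SET (fun=> B) A (ltnW (ltn_ord k)).
  rewrite big_set1 => <-//; last first.
    by move=> i; rewrite inE => /eqP ->.
  congr (P (_ `&` _)); apply/seteqP; split=> w /=.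
    by move=> ? i /=; rewrite inE => /eqP ->.
  by apply; rewrite /= inE.
rewrite fubini_tonelli1//.
rewrite ge0_integral_distribution//; last 2 first.
- exact: measurable_fun_fubini_tonelli_F.
- by move=> s; apply: integral_ge0.
apply: eq_integral => w _; rewrite /fubini_F/=.
rewrite ge0_integral_distribution//.
have mp : measurable_fun [set: R] (fun y : R => (partial_sum k w, y)).
  exact: measurable_fun_pair.
exact: (measurableT_comp mh mp).
Qed.

End partial_sums.

(** * Lindeberg replacement *)

Section lindeberg.
Context {R : realType}.
Local Notation gauss := (@std_normal R).

(* [smooth_pos3 t u = E (u + t Z)_+^3]; as a function of [t ^+ 2] this is the
   heat flow started at [u_+^3]. *)
Definition smooth_pos3 (t u : R) : \bar R :=
  (\int[gauss]_z (pos_part (u + t * z) ^+ 3)%:E)%E.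

Lemma smooth_pos3_ge0 t u : (0 <= smooth_pos3 t u)%E.
Proof. by apply: integral_ge0 => z _; rewrite lee_fin pos_part3_ge0. Qed.

Lemma measurable_smooth_pos3 t : measurable_fun [set: R] (smooth_pos3 t).
Proof.
apply: (@measurable_fun_integral _ _ R (measurableTypeR R) R gauss
  (fun u z => (pos_part (u + t * z) ^+ 3)%:E)).
  apply/measurable_EFinP; apply: (measurableT_comp measurable_pos_part3).
  by apply: measurable_funD => //; exact: measurable_funM.
by move=> u z; rewrite lee_fin pos_part3_ge0.
Qed.

(** Semigroup property of the heat flow: variances add. *)
Lemma smooth_pos3_convolution (s t u : R) : 0 <= s -> 0 <= t ->
  (\int[gauss]_z smooth_pos3 s (u + t * z)%R =
   smooth_pos3 (Num.sqrt (t ^+ 2 + s ^+ 2)) u)%E.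
Proof.
move=> s0 t0.
have c3 : continuous (fun v : R => pos_part (u + v) ^+ 3).
  move=> v; apply: (@continuous_comp _ _ _ (fun v => u + v)
      (fun v => pos_part v ^+ 3)); last exact: continuous_pos_part3.
  by apply: cvgD; [exact: cvg_cst|exact: cvg_id].
rewrite /smooth_pos3 -(std_normal_convolution t0 s0 c3); last first.
  by move=> v; exact: pos_part3_ge0.
by apply: eq_integral => z _; apply: eq_integral => z' _; rewrite addrA.
Qed.

(** Jensen's inequality for the convex function [u_+^3], obtained by discarding the second-order
    term of the normal lower bound. *)
Lemma le_smooth_pos3 t u : ((pos_part u ^+ 3)%:E <= smooth_pos3 t u)%E.
Proof.
apply: le_trans (integral_pos_part3_std_normal_ge t u).
by rewrite lee_fin lerDl mulr_ge0 ?sqr_ge0// mulr_ge0 ?pos_part_ge0.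
Qed.

Section replacement.
Context d (T : measurableType d) (P : probability T R).

(** One replacement under smoothing. Tonelli puts the smoothing variable [z] outside; for fixed [z]
    the Taylor upper bound for [X] and the lower bound for a normal of the same variance share the
    same second-order expression at [u + t * z]. The two smoothings then merge. *)
Lemma integral_smooth_pos3D_le (X : {RV P >-> R}) (s t u : R) :
  0 <= s -> 0 <= t ->
  ('E_P[X] <= 0)%E -> (\int[P]_w (X w ^+ 2)%:E = (s ^+ 2)%:E)%E ->
  (\int[P]_w smooth_pos3 t (u + X w)%R <=
   smooth_pos3 (Num.sqrt (t ^+ 2 + s ^+ 2)) u +
   \int[P]_w (pos_part (X w) ^+ 3)%:E)%E.
Proof.
move=> s0 t0 X1 X2; rewrite /smooth_pos3.
have p30 (v : R) : (0 <= (pos_part v ^+ 3)%:E)%E.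
  by rewrite lee_fin pos_part3_ge0.
have mh : measurable_fun [set: T * measurableTypeR R]
    (fun p => (pos_part (u + X p.1 + t * p.2) ^+ 3)%:E).
  apply/measurable_EFinP; apply: (measurableT_comp measurable_pos_part3).
  apply: measurable_funD; last exact: measurable_funM.
  by apply: measurable_funD => //; apply: measurableT_comp.
rewrite integral_exchange//.
set b := (\int[P]_w (pos_part (X w) ^+ 3)%:E)%E.
have b0 : (0 <= b)%E by apply: integral_ge0 => w _.
have msm : measurable_fun [set: R] (fun z => smooth_pos3 s (u + t * z)%R).
  apply: (measurableT_comp (measurable_smooth_pos3 s)).
  by apply: measurable_funD => //; exact: measurable_funM.
apply: (@le_trans _ _ (\int[gauss]_z (smooth_pos3 s (u + t * z)%R + b))%E).
  apply: ge0_le_integral => //.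
  - by move=> z _; apply: integral_ge0.
  - apply: (@measurable_fun_integral _ _ (measurableTypeR R) T R P
      (fun z w => (pos_part (u + X w + t * z) ^+ 3)%:E)) => //.
    apply/measurable_EFinP; apply: (measurableT_comp measurable_pos_part3).
    apply: measurable_funD; last exact: measurable_funM.
    by apply: measurable_funD => //; apply: measurableT_comp.
  - by apply: emeasurable_funD.
  - move=> z _; under eq_integral do rewrite addrAC.
    apply: le_trans (integral_pos_part3D_le _ X1 X2) _.
    by rewrite leeD2r//; exact: integral_pos_part3_std_normal_ge.
rewrite ge0_integralD//; last by move=> z _; exact: smooth_pos3_ge0.
by rewrite smooth_pos3_convolution// integral_probability_cst.
Qed.

Variables (n : nat) (X : 'I_n -> {RV P >-> R}) (s : 'I_n -> R).
Hypothesis indX : independent_RVs X.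
Hypothesis X1 : (forall i, 'E_P[X i] <= 0)%E.
Hypothesis s0 : forall i, 0 <= s i.
Hypothesis X2 : (forall i, \int[P]_w (X i w ^+ 2)%:E = (s i ^+ 2)%:E)%E.
Hypothesis s1 : \sum_(i < n) s i ^+ 2 <= 1.

(** The variance still carried by the normal smoothing once the first [k] summands are in place. *)
Let remaining_variance (k : nat) : R := 1 - \sum_(i < n | (i < k)%N) s i ^+ 2.

Let remaining_variance_ge0 k : 0 <= remaining_variance k.
Proof.
rewrite subr_ge0; apply: le_trans s1.
rewrite [leRHS](bigID (fun i : 'I_n => (i < k)%N))/= lerDl sumr_ge0// => i _.
by rewrite sqr_ge0.
Qed.

Let remaining_varianceS (k : 'I_n) :
  remaining_variance k = remaining_variance k.+1 + s k ^+ 2.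
Proof.
rewrite /remaining_variance [in RHS](bigD1 k)//= opprD addrA addrAC subrK.
congr (_ - _); apply: eq_bigl => i.
by rewrite ltnS andbC ltn_neqAle.
Qed.

(** Starting from a single normal of variance [1], the summands enter one at a time while the
    smoothing loses the matching variance; each entry costs at most [b i]. *)
Lemma lindeberg_pos_part3 (x : R) :
  (\int[P]_w (pos_part (\sum_(i < n) X i w - x) ^+ 3)%:E <=
   \int[gauss]_z (pos_part (z - x) ^+ 3)%:E +
   \sum_(i < n) \int[P]_w (pos_part (X i w) ^+ 3)%:E)%E.
Proof.
pose b i := (\int[P]_w (pos_part (X i w) ^+ 3)%:E)%E.
have b0 i : (0 <= b i)%E.
  by apply: integral_ge0 => w _; rewrite lee_fin pos_part3_ge0.
pose t k := Num.sqrt (remaining_variance k).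
have t0 k : 0 <= t k by exact: sqrtr_ge0.
have mS k u : measurable_fun [set: T] (fun w => smooth_pos3 u (partial_sum X k w - x)%R).
  apply: (measurableT_comp (measurable_smooth_pos3 u)).
  by apply: measurable_funD.
have step k : (k <= n)%N ->
    (\int[P]_w smooth_pos3 (t k) (partial_sum X k w - x)%R <=
     smooth_pos3 1 (- x) + \sum_(i < n | (i < k)%N) b i)%E.
  elim: k => [|k IH] kn.
    rewrite [X in (_ + X)%E]big_pred0// adde0.
    rewrite /t /remaining_variance big_pred0// subr0 sqrtr1.
    under eq_integral do rewrite partial_sum0 sub0r.
    by rewrite integral_probability_cst.
  pose i0 := Ordinal kn.
  rewrite (bigD1 i0)//= [X in (_ + (_ + X))%E](eq_bigl
    (fun i : 'I_n => (i < k)%N)); last first.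
    by move=> i; rewrite ltnS andbC ltn_neqAle.
  under eq_integral do rewrite (partial_sumS _ i0).
  have mh : measurable_fun [set: R * R] (fun p => smooth_pos3 (t k.+1) (p.1 + p.2 - x)).
    apply: (measurableT_comp (measurable_smooth_pos3 _)).
    by apply: measurable_funD => //; exact: measurable_funD.
  rewrite (@integral_partial_sum_pair _ _ _ _ _ _ indX i0
    (fun a b => smooth_pos3 (t k.+1) (a + b - x)) mh); last first.
    by move=> *; exact: smooth_pos3_ge0.
  (* With [w] frozen, the one-step bound is applied at [u = partial_sum X k w - x]. *)
  apply: (@le_trans _ _ (\int[P]_w
      (smooth_pos3 (t k) (partial_sum X k w - x)%R + b i0))%E).
    apply: ge0_le_integral => //.
    - by move=> w _; apply: integral_ge0 => w' _; exact: smooth_pos3_ge0.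
    - apply: (@measurable_fun_integral _ _ T T R P
        (fun w w' => smooth_pos3 (t k.+1) (partial_sum X k w + X i0 w' - x))).
        apply: (measurableT_comp (measurable_smooth_pos3 _)).
        apply: measurable_funD => //; apply: measurable_funD.
          exact: (measurableT_comp (f := partial_sum X k)).
        exact: (measurableT_comp (f := X i0)).
      by move=> *; exact: smooth_pos3_ge0.
    - exact: emeasurable_funD.
    - move=> w _; under eq_integral do rewrite addrAC.
      have -> : t k = Num.sqrt (t k.+1 ^+ 2 + s i0 ^+ 2).
        by rewrite /t sqr_sqrtr// -(remaining_varianceS i0).
      exact: integral_smooth_pos3D_le.
  rewrite ge0_integralD//; last by move=> w _; exact: smooth_pos3_ge0.
  rewrite integral_probability_cst [leRHS]addeCA [leLHS]addeC.
  by apply: leeD2l; apply: IH; exact: ltnW.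
have := step n (leqnn n).
rewrite (eq_bigl xpredT); last by move=> i; rewrite ltn_ord.
under [X in (_ <= X + _)%E -> _]eq_integral do rewrite mul1r addrC.
(* If the variances sum to less than [1], some smoothing is left; removing it can only lower the
   integral. *)
apply: le_trans; apply: ge0_le_integral => //.
- by move=> w _; rewrite lee_fin pos_part3_ge0.
- apply/measurable_EFinP; apply: (measurableT_comp measurable_pos_part3).
  by apply: measurable_funD => //; exact: measurable_sum.
- move=> w _; rewrite [in leLHS](eq_bigl (fun i : 'I_n => (i < n)%N)); last first.
    by move=> i; rewrite ltn_ord.
  exact: le_smooth_pos3.
Qed.

End replacement.
End lindeberg.

(** * The upper bounds for one-sided and absolute third moments *)

Section upper_bounds.
Context {R : realType}.
Local Notation gauss := (@std_normal R).

Lemma expectationE d (T : measurableType d) (P : probability T R) (f : T -> R) :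
  ('E_P[f] = \int[P]_w (f w)%:E)%E.
Proof. by rewrite unlock. Qed.

Lemma expectation_standard_normal d (T : measurableType d)
    (P : probability T R) (Z : {RV P >-> R}) (h : R -> R) :
  standard_normal Z -> measurable_fun [set: R] h -> (forall u, 0 <= h u) ->
  ('E_P[fun w => h (Z w)] = \int[gauss]_z (h z)%:E)%E.
Proof.
move=> hZ mh h0; rewrite expectationE.
(* The law of [Z] is compared with [std_normal], which lives on [measurableTypeR R]. *)
have mZ : measurable_fun [set: T] (Z : T -> measurableTypeR R).
  by move=> _ A mA; rewrite setTI -[X in measurable X]setTI; exact: measurable_funP.
transitivity (\int[pushforward P (Z : T -> measurableTypeR R)]_z (h z)%:E)%E.
  rewrite ge0_integral_pushforward//; last by move=> z _; rewrite lee_fin.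
  exact/measurable_EFinP.
by apply: eq_measure_integral => A mA _; exact: hZ.
Qed.

Section independent.
Context d (T : measurableType d) (P : probability T R).

Lemma expectation_pos_part3_le (n : nat) (X : 'I_n -> {RV P >-> R}) (x : R) :
  independent_RVs X -> (forall i, 'E_P[X i] <= 0)%E ->
  (\sum_(i < n) 'E_P[fun w => (X i w ^+ 2)%R] <= 1)%E ->
  ('E_P[fun w => (pos_part (\sum_(i < n) X i w - x) ^+ 3)%R] <=
   \int[gauss]_z (pos_part (z - x) ^+ 3)%:E +
   \sum_(i < n) 'E_P[fun w => (pos_part (X i w) ^+ 3)%R])%E.
Proof.
move=> indX X1 X2.
have sq0 i : (0 <= 'E_P[fun w => (X i w ^+ 2)%R])%E.
  by apply: expectation_ge0 => w; rewrite sqr_ge0.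
(* Each second moment is at most the total, hence at most [1]; so [fine] below loses nothing. *)
have sq_fin i : 'E_P[fun w => (X i w ^+ 2)%R]%E \is a fin_num.
  rewrite ge0_fin_numE//; apply: (@le_lt_trans _ _ 1%E); last exact: ltry.
  by apply: le_trans X2; rewrite (bigD1 i)//= leeDl// sume_ge0.
pose s i := Num.sqrt (fine 'E_P[fun w => (X i w ^+ 2)%R]%E).
have sE i : ('E_P[fun w => (X i w ^+ 2)%R] = (s i ^+ 2)%:E)%E.
  by rewrite /s sqr_sqrtr ?fine_ge0// fineK.
rewrite expectationE; under [in leRHS]eq_bigr do rewrite expectationE.
apply: (@lindeberg_pos_part3 _ _ _ P n X s) => //.
- by move=> i; exact: sqrtr_ge0.
- by move=> i; rewrite -sE expectationE.
- by rewrite -lee_fin -sumEFin; under eq_bigr do rewrite -sE.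
Qed.

Definition oppRV (Y : {RV P >-> R}) (w : T) : R := - Y w.

Let measurable_oppRV (Y : {RV P >-> R}) : measurable_fun [set: T] (oppRV Y).
Proof. by apply: measurableT_comp => //; exact: oppr_measurable. Qed.

HB.instance Definition _ (Y : {RV P >-> R}) :=
  isMeasurableFun.Build d _ T R (oppRV Y) (measurable_oppRV Y).

Lemma independent_oppRV (n : nat) (X : 'I_n -> {RV P >-> R}) :
  independent_RVs X -> independent_RVs (fun i => oppRV (X i) : {RV P >-> R}).
Proof.
move=> indX J B mB.
have mN i : i \in J -> measurable (-%R @^-1` B i).
  move=> iJ; rewrite -[X in measurable X]setTI.
  by apply: oppr_measurable => //; exact: mB.
exact: (indX J (fun i => -%R @^-1` B i) mN).
Qed.

Lemma expectation_oppRV (Y : {RV P >-> R}) :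
  ('E_P[fun w => (Y w ^+ 2)%R] < +oo)%E -> ('E_P[oppRV Y] = - 'E_P[Y])%E.
Proof.
rewrite !expectationE => /integrable_of_sqr iY.
by rewrite -integralN//; exact: integrable_add_def.
Qed.

Lemma integral_normr3 d' (T' : measurableType d')
    (m : {measure set T' -> \bar R}) (f : T' -> R) :
  measurable_fun [set: T'] f ->
  (\int[m]_w (`|f w| ^+ 3)%:E = \int[m]_w (pos_part (f w) ^+ 3)%:E +
   \int[m]_w (pos_part (- f w) ^+ 3)%:E)%E.
Proof.
move=> mf; rewrite -ge0_integralD//.
- by apply: eq_integral => w _; rewrite normr3_pos_part.
- by move=> w _; rewrite lee_fin pos_part3_ge0.
- by apply/measurable_EFinP; exact: (measurableT_comp measurable_pos_part3).
- by move=> w _; rewrite lee_fin pos_part3_ge0.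
- apply/measurable_EFinP; apply: (measurableT_comp measurable_pos_part3).
  exact: measurable_funN.
Qed.

(** Zero means allow the one-sided bound both for [X] at [x] and for [- X] at [- x]; the positive
    and negative parts of each cube then recombine. *)
Lemma expectation_normr3_le (n : nat) (X : 'I_n -> {RV P >-> R}) (x : R) :
  independent_RVs X -> (forall i, 'E_P[X i] = 0)%E ->
  (\sum_(i < n) 'E_P[fun w => (X i w ^+ 2)%R] <= 1)%E ->
  ('E_P[fun w => (`|\sum_(i < n) X i w - x| ^+ 3)%R] <=
   \int[gauss]_z (`|z - x| ^+ 3)%:E +
   \sum_(i < n) 'E_P[fun w => (`|X i w| ^+ 3)%R])%E.
Proof.
move=> indX X1 X2.
have mS : measurable_fun [set: T] (fun w => \sum_(i < n) X i w - x).
  by apply: measurable_funD => //; exact: measurable_sum.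
have up : ('E_P[fun w => (pos_part (\sum_(i < n) X i w - x) ^+ 3)%R] <=
   \int[gauss]_z (pos_part (z - x) ^+ 3)%:E +
   \sum_(i < n) 'E_P[fun w => (pos_part (X i w) ^+ 3)%R])%E.
  by apply: expectation_pos_part3_le => // i; rewrite X1.
have down : ('E_P[fun w => (pos_part (- (\sum_(i < n) X i w - x)) ^+ 3)%R] <=
   \int[gauss]_z (pos_part (- (z - x)) ^+ 3)%:E +
   \sum_(i < n) 'E_P[fun w => (pos_part (- X i w) ^+ 3)%R])%E.
  have sym : (\int[gauss]_z (pos_part (- (z - x)) ^+ 3)%:E =
      \int[gauss]_z (pos_part (z - - x) ^+ 3)%:E)%E.
    rewrite -(std_normal_symmetric (f := fun z => (pos_part (z - - x) ^+ 3)%:E)).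
    - by apply: eq_integral => z _; rewrite opprB opprK addrC.
    - apply/measurable_EFinP; apply: (measurableT_comp measurable_pos_part3).
      exact: measurable_funD.
    - by move=> z; rewrite lee_fin pos_part3_ge0.
  have sq_lty i : ('E_P[fun w => (X i w ^+ 2)%R] < +oo)%E.
    apply: (@le_lt_trans _ _ 1%E); last exact: ltry.
    apply: le_trans X2; rewrite (bigD1 i)//= leeDl// sume_ge0// => j _.
    by apply: expectation_ge0 => w; rewrite sqr_ge0.
  rewrite (_ : (fun w => _) = (fun w =>
      pos_part (\sum_(i < n) oppRV (X i) w - (- x)) ^+ 3)); last first.
    by apply/funext => w; rewrite sumrN opprB opprK addrC.
  rewrite sym.
  apply: (@expectation_pos_part3_le n (fun i => oppRV (X i) : {RV P >-> R})).
  - exact: independent_oppRV.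
  - by move=> i; rewrite expectation_oppRV// X1 oppe0.
  - rewrite (eq_bigr (fun i => 'E_P[fun w => (X i w ^+ 2)%R])%E)// => i _.
    by congr expectation; apply/funext => w; rewrite /oppRV/= sqrrN.
rewrite [leLHS](_ : _ =
    'E_P[fun w => (pos_part (\sum_(i < n) X i w - x) ^+ 3)%R] +
    'E_P[fun w => (pos_part (- (\sum_(i < n) X i w - x)) ^+ 3)%R])%E; last first.
  by rewrite !expectationE integral_normr3.
have -> : (\int[gauss]_z (`|z - x| ^+ 3)%:E =
    \int[gauss]_z (pos_part (z - x) ^+ 3)%:E +
    \int[gauss]_z (pos_part (- (z - x)) ^+ 3)%:E)%E.
  by apply: integral_normr3; exact: measurable_funD.
apply: (le_trans (leeD up down)); rewrite addeACA.
apply: leeD2l; rewrite -big_split/=; apply: lee_sum => i _.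
by rewrite !expectationE -integral_normr3.
Qed.

End independent.
End upper_bounds.

(** * Independent families with prescribed laws *)

Section independent_family.
Context {R : realType}.
Variable mu : nat -> probability R R.

Section extension.
Context d (T : measurableType d) (P : probability T R).
Variables (n : nat) (X : 'I_n -> {RV P >-> R}) (nu : probability R R).

(** [unlift ord_max i] is [None] exactly at the last index, which reads the new coordinate. *)
Definition extended_family (i : 'I_n.+1) (p : T * R) : R :=
  if unlift ord_max i is Some j then X j p.1 else p.2.

Let measurable_extended_family i :
  measurable_fun [set: T * R] (extended_family i).
Proof.
rewrite /extended_family; case: unlift => [j|]; last exact: measurable_snd.
by apply: measurableT_comp => //; exact: measurable_fst.
Qed.

HB.instance Definition _ i :=
  isMeasurableFun.Build _ _ (T * R)%type R (extended_family i)
    (measurable_extended_family i).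

Let PR : probability (T * R)%type R := (P \x nu)%E.

Let extended_family_lift j (B : set R) :
  extended_family (lift ord_max j) @^-1` B = (X j @^-1` B) `*` setT.
Proof.
by apply/seteqP; split=> [[w y]|[w y] []] /=; rewrite /extended_family /preimage/= liftK.
Qed.

Let extended_family_max (B : set R) :
  extended_family ord_max @^-1` B = setT `*` B.
Proof.
by apply/seteqP; split=> [[w y]|[w y] []] /=; rewrite /extended_family /preimage/= unlift_none.
Qed.

Let mX j (B : set R) : measurable B -> measurable (X j @^-1` B).
Proof. by move=> mB; rewrite -[X in measurable X]setTI; exact: measurable_funP. Qed.

Lemma extended_family_law_lift j (B : set R) : measurable B ->
  PR (extended_family (lift ord_max j) @^-1` B) = P (X j @^-1` B).
Proof.
move=> mB; rewrite extended_family_lift [LHS]product_measure1E//; last exact: mX.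
by rewrite [X in (_ * X)%E]probability_setT mule1.
Qed.

Lemma extended_family_law_max (B : set R) : measurable B ->
  PR (extended_family ord_max @^-1` B) = nu B.
Proof.
move=> mB; rewrite extended_family_max [LHS]product_measure1E//.
by rewrite [X in (X * _)%E]probability_setT mul1e.
Qed.

(** A joint event is a rectangle: an event of the old family times a condition on the new
    coordinate. *)
Lemma extended_family_independent : independent_RVs X ->
  @independent_RVs R _ _ PR n.+1 (fun i => extended_family i).
Proof.
move=> indX J B mB.
pose J' : {set 'I_n} := [set j | lift ord_max j \in J]%SET.
pose B' (j : 'I_n) := B (lift ord_max j).
(* When the last index is not in [J], the default [setT] contributes the factor [1]. *)
pose C := if ord_max \in J then B ord_max else setT.
have mC : measurable C by rewrite /C; case: ifPn => // /mB.
have mB' j : j \in J' -> measurable (B' j) by rewrite inE => /mB.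
have -> : \bigcap_(i in [set` J]) (extended_family i @^-1` B i) =
    (\bigcap_(j in [set` J']) (X j @^-1` B' j)) `*` C.
  apply/seteqP; split=> [[w y] h|[w y] [/= h1 h2] i /= iJ].
    split=> /=.
      move=> j /=; rewrite inE => jJ; have := h _ jJ.
      by rewrite extended_family_lift => -[].
    rewrite /C; case: ifPn => // mJ; have := h _ mJ.
    by rewrite extended_family_max => -[].
  case: (unliftP ord_max i) => [j|] ie; rewrite ie in iJ *.
    rewrite /preimage/= /extended_family liftK.
    by apply: h1; rewrite /= inE.
  by move: h2; rewrite /preimage/= /extended_family unlift_none /C iJ.
rewrite [LHS]product_measure1E//; last first.
  by apply: fin_bigcap_measurable => // j /= jJ; apply: mX; exact: mB'.
transitivity ((\prod_(j in J') P (X j @^-1` B' j)) * nu C)%E.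
  by congr (_ * _)%E; exact: indX.
rewrite [RHS]big_mkcond big_ord_recr/= -big_mkcond/=; congr (_ * _)%E.
  rewrite [LHS]big_mkcond [RHS]big_mkcond; apply: eq_bigr => j _.
  have -> : widen_ord (leqnSn n) j = lift ord_max j.
    by apply: val_inj; apply/esym; exact: lift_max.
  rewrite inE; case: ifPn => // jJ; rewrite extended_family_law_lift//.
  exact: mB.
rewrite /C; case: ifPn => mJ; last by rewrite probability_setT.
by rewrite extended_family_law_max//; exact: mB.
Qed.

End extension.

(** Iterated product spaces, starting from a one-point space. *)
Lemma exists_independent_RVs (n : nat) :
  exists (d : measure_display) (T : measurableType d) (P : probability T R)
    (X : 'I_n -> {RV P >-> R}), independent_RVs X /\
    forall i (B : set R), measurable B -> P (X i @^-1` B) = mu i B.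
Proof.
elim: n => [|n [d [T [P [X [indX lawX]]]]]].
  exists _, unit, \d_tt, (fun=> cst 0); split=> [J B _|[]//].
  rewrite (_ : J = finset.set0); last by apply/setP => -[].
  rewrite big_set0 (_ : \bigcap_(i in _) _ = setT) ?probability_setT//.
  by apply/seteqP; split=> // w _ i /=; rewrite inE.
exists _, _, (P \x mu n)%E, (fun i => extended_family X i); split.
  exact: extended_family_independent.
move=> i B mB; case: (unliftP ord_max i) => [j|] ->.
  by rewrite extended_family_law_lift// lawX// lift_max.
exact: extended_family_law_max.
Qed.

End independent_family.

(** * Scaled normal laws and symmetric jump laws *)

Section laws.
Context {R : realType}.
Local Notation gauss := (@std_normal R).

Lemma ge0_integral_of_law d (T : measurableType d) (P : probability T R)
    (X : {RV P >-> R}) (mu : probability R R) (h : R -> \bar R) :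
  (forall B : set R, measurable B -> P (X @^-1` B) = mu B) ->
  measurable_fun [set: R] h -> (forall u, 0 <= h u)%E ->
  (\int[P]_w h (X w) = \int[mu]_u h u)%E.
Proof.
move=> lawX mh h0.
rewrite -(ge0_integral_distribution X mh h0).
by apply: eq_measure_integral => B mB _; exact: lawX.
Qed.

(** Symmetry is expressed through positive parts because the change-of-law lemmas handle nonnegative
    functions. The finite second moment makes both parts integrable, so they may be subtracted. *)
Lemma expectation_symmetric d (T : measurableType d) (P : probability T R)
    (X : {RV P >-> R}) :
  ('E_P[fun w => (X w ^+ 2)%R] < +oo)%E ->
  (\int[P]_w (pos_part (X w))%:E = \int[P]_w (pos_part (- X w))%:E)%E ->
  ('E_P[X] = 0)%E.
Proof.
rewrite !expectationE => /integrable_of_sqr iX symX.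
have posE : (\int[P]_w (EFin \o X)^\+ w = \int[P]_w (pos_part (X w))%:E)%E.
  by apply: eq_integral => w _; rewrite funeposE /pos_part maxC EFin_max.
have negE : (\int[P]_w (EFin \o X)^\- w = \int[P]_w (pos_part (- X w))%:E)%E.
  by apply: eq_integral => w _; rewrite funenegE /pos_part maxC EFin_max.
rewrite integralE negE -symX -posE subee//; exact: integrable_pos_fin_num.
Qed.

(* [normal_prob] lives on [measurableTypeR R]; [scale] transports it to the
   measurable structure of [R] itself. *)
Definition scale (s : R) (z : measurableTypeR R) : R := s * z.

Let measurable_scale s : measurable_fun [set: measurableTypeR R] (scale s).
Proof. exact: measurable_funM. Qed.

HB.instance Definition _ s :=
  isMeasurableFun.Build _ _ _ _ (scale s) (measurable_scale s).

Definition scaled_normal (s : R) : probability R R := distribution gauss (scale s).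

Lemma ge0_integral_scaled_normal s (h : R -> \bar R) :
  measurable_fun [set: R] h -> (forall u, 0 <= h u)%E ->
  (\int[scaled_normal s]_u h u = \int[gauss]_z h (s * z)%R)%E.
Proof. by move=> mh h0; rewrite ge0_integral_distribution. Qed.

Definition jump (M : R) (b : bool * bool) : R :=
  if b.1 then (if b.2 then M else - M) else 0.

Let measurable_jump M : measurable_fun [set: bool * bool] (jump M).
Proof.
apply: measurable_fun_ifT => //=; apply: measurable_fun_ifT => //=.
Qed.

HB.instance Definition _ M :=
  isMeasurableFun.Build _ _ _ _ (jump M) (measurable_jump M).

(* The symmetric law with mass [p / 2] at [M] and at [- M] and mass [1 - p] at
   [0], realised through two independent Bernoulli variables. *)
Definition jump_law (p M : R) : probability R R :=
  distribution (bernoulli_prob p \x bernoulli_prob 2^-1)%E (jump M).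

Lemma ge0_integral_jump_law p M (h : R -> R) : 0 <= p <= 1 ->
  measurable_fun [set: R] h -> (forall u, 0 <= h u) ->
  (\int[jump_law p M]_u (h u)%:E =
   ((1 - p) * h 0 + p * ((h M + h (- M)) / 2))%:E)%E.
Proof.
move=> p01 mh h0.
have mhE : measurable_fun [set: R] (fun u => (h u)%:E) by exact/measurable_EFinP.
have hE u : (0 <= (h u)%:E)%E by rewrite lee_fin.
have half : 0 <= (2^-1 : R) <= 1 by rewrite invr_ge0 ler0n invf_le1// ler1n.
rewrite ge0_integral_distribution// fubini_tonelli1; last 2 first.
- exact: (measurableT_comp mhE (measurable_jump M)).
- by move=> b; exact: hE.
rewrite (integral_bernoulli_prob p01); last first.
  by move=> b; apply: integral_ge0 => c _; exact: hE.
rewrite /fubini_F !(integral_bernoulli_prob half)//=.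
transitivity ((p * (2^-1 * h M + (1 - 2^-1) * h (- M)) +
  (1 - p) * (2^-1 * h 0 + (1 - 2^-1) * h 0))%:E); first by [].
by congr EFin; field.
Qed.

End laws.

(** * Near-extremal sums *)

Section extremal_sum.
Context {R : realType} d (T : measurableType d) (P : probability T R).
Local Notation gauss := (@std_normal R).
Variables (m : nat) (X : 'I_m.+1 -> {RV P >-> R}) (s p M : R).
Hypothesis indX : independent_RVs X.
Hypothesis s0 : 0 <= s.
Hypothesis p01 : 0 <= p <= 1.
Hypothesis M0 : 0 <= M.
Hypothesis lawX : forall (i : 'I_m.+1) (B : set R), measurable B ->
  P (X i @^-1` B) = (if (i < m)%N then scaled_normal s else jump_law p M) B.

Lemma integral_normal_summand (i : 'I_m.+1) (h : R -> \bar R) : (i < m)%N ->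
  measurable_fun [set: R] h -> (forall u, 0 <= h u)%E ->
  (\int[P]_w h (X i w) = \int[gauss]_z h (s * z)%R)%E.
Proof.
move=> im mh h0; rewrite -ge0_integral_scaled_normal//.
by apply: ge0_integral_of_law => // B mB; rewrite lawX// im.
Qed.

Lemma integral_jump_summand (h : R -> R) :
  measurable_fun [set: R] h -> (forall u, 0 <= h u) ->
  (\int[P]_w (h (X ord_max w))%:E =
   ((1 - p) * h 0 + p * ((h M + h (- M)) / 2))%:E)%E.
Proof.
move=> mh h0; rewrite -ge0_integral_jump_law//.
apply: (@ge0_integral_of_law _ _ _ _ _ _ (fun u => (h u)%:E)) => [B mB||u].
- by rewrite lawX//= ltnn.
- exact/measurable_EFinP.
- by rewrite lee_fin.
Qed.

(** Induction on [k] for all [h] at once: with the last normal frozen at [s * z], the induction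
    hypothesis is used for a translate of [h], and the two normals then recombine. *)
Lemma integral_normal_partial_sum k (h : R -> R) : (k <= m)%N ->
  continuous h -> (forall u, 0 <= h u) ->
  (\int[P]_w (h (partial_sum X k w))%:E =
   \int[gauss]_z (h (Num.sqrt (k%:R * s ^+ 2) * z))%:E)%E.
Proof.
elim: k h => [|k IH] h km ch h0.
  under eq_integral do rewrite partial_sum0.
  under [RHS]eq_integral do rewrite mul0r sqrtr0 mul0r.
  by rewrite !integral_probability_cst.
have mh : measurable_fun [set: R] h by exact: continuous_measurable_fun.
have km1 : (k < m.+1)%N by apply: ltnW.
pose i0 := Ordinal km1.
under eq_integral do rewrite (partial_sumS _ i0).
have mh2 : measurable_fun [set: R * R] (fun q : R * R => (h (q.1 + q.2))%:E).
  apply/measurable_EFinP; apply: (measurableT_comp mh).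
  exact: measurable_funD.
rewrite (@integral_partial_sum_pair _ _ _ _ _ _ indX i0
  (fun a b => (h (a + b))%:E) mh2); last by move=> *; rewrite lee_fin.
under eq_integral.
  move=> w _.
  rewrite (@integral_normal_summand i0
    (fun u => (h (partial_sum X k w + u))%:E))//=; last 2 first.
  - apply/measurable_EFinP; apply: (measurableT_comp mh).
    exact: measurable_funD.
  - by move=> u; rewrite lee_fin.
  over.
rewrite (@integral_exchange _ _ _ _ _ P gauss
  (fun w z => (h (partial_sum X k w + s * z))%:E)); last 2 first.
- apply/measurable_EFinP; apply: (measurableT_comp mh).
  apply: measurable_funD; last exact: measurable_funM.
  exact: (measurableT_comp (f := partial_sum X k)).
- by move=> *; rewrite lee_fin.
under eq_integral.
  move=> z _.
  rewrite (IH (fun u => h (u + s * z)) (ltnW km))//; last first.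
    move=> u; apply: (@continuous_comp _ _ _ (fun u => u + s * z) h); last exact: ch.
    by apply: cvgD; [exact: cvg_id|exact: cvg_cst].
  under eq_integral do rewrite addrC.
  over.
rewrite std_normal_convolution//.
apply: eq_integral => z _; rewrite sqr_sqrtr ?mulr_ge0 ?sqr_ge0//.
by rewrite -{1}(mul1r (s ^+ 2)) -mulrDl -natr1 (addrC 1).
Qed.

(** Convexity of the cube at [A = |a + M|] and [B = |a - M|], whose mean is at least [M]; the
    convexity gap is [3 / 8 * (A + B) * (A - B) ^+ 2]. *)
Let jump_convexity (a : R) :
  M ^+ 3 <= (`|a + M| ^+ 3 + `|a - M| ^+ 3) / 2.
Proof.
have A0 := normr_ge0 (a + M); have B0 := normr_ge0 (a - M).
have AB : 2 * M <= `|a + M| + `|a - M|.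
  apply: le_trans (ler_normB (a + M) (a - M)).
  by rewrite (_ : a + M - (a - M) = 2 * M) ?ler_norm//; ring.
move: A0 B0 AB; set A := `|a + M|; set B := `|a - M| => A0 B0 AB.
have AB3 : (2 * M) ^+ 3 <= (A + B) ^+ 3 by rewrite lerXn2r// nnegrE ?addr_ge0// mulr_ge0.
have : 0 <= (A + B) * (A - B) ^+ 2 by rewrite mulr_ge0 ?sqr_ge0// addr_ge0.
move=> AB2; rewrite -subr_ge0 in AB3; rewrite -subr_ge0.
rewrite [leRHS](_ : _ = ((A + B) ^+ 3 - (2 * M) ^+ 3) / 8 + 3 * ((A + B) * (A - B) ^+ 2) / 8).
  by rewrite addr_ge0// divr_ge0// mulr_ge0.
by field.
Qed.

(** With probability [1 - p] no jump occurs and the normal part remains. Otherwise averaging over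
    the sign of the jump gives at least [M ^+ 3], wherever the normal part lies. *)
Lemma integral_normr3_extremal_ge (x : R) :
  ((1 - p)%:E * \int[gauss]_z (`|Num.sqrt (m%:R * s ^+ 2) * z - x| ^+ 3)%:E +
   (p * M ^+ 3)%:E <=
   \int[P]_w (`|\sum_(i < m.+1) X i w - x| ^+ 3)%:E)%E.
Proof.
have ch : continuous (fun u : R => `|u - x| ^+ 3).
  move=> u; apply: (@continuous_comp _ _ _ (fun u : R => `|u - x|)
    (fun u => u ^+ 3)); last exact: exprn_continuous.
  apply: (@continuous_comp _ _ _ (fun u : R => u - x) (fun u => `|u|)).
    by apply: cvgB; [exact: cvg_id|exact: cvg_cst].
  exact: norm_continuous.
have mh : measurable_fun [set: R] (fun u : R => `|u - x| ^+ 3).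
  exact: continuous_measurable_fun.
have h0 (u : R) : 0 <= `|u - x| ^+ 3 by rewrite exprn_ge0.
have sumE w : \sum_(i < m.+1) X i w = partial_sum X m w + X ord_max w.
  rewrite -[RHS](partial_sumS X ord_max w).
  by apply: eq_bigl => i; rewrite ltn_ord.
under [leRHS]eq_integral do rewrite sumE.
have mh2 : measurable_fun [set: R * R] (fun q : R * R => (`|q.1 + q.2 - x| ^+ 3)%:E).
  apply/measurable_EFinP; apply: (measurableT_comp mh).
  exact: measurable_funD.
rewrite (@integral_partial_sum_pair _ _ _ _ _ _ indX ord_max
  (fun a b => (`|a + b - x| ^+ 3)%:E) mh2); last by move=> *; rewrite lee_fin.
under [leRHS]eq_integral.
  move=> w _.
  rewrite (@integral_jump_summand (fun u => `|partial_sum X m w + u - x| ^+ 3)); last 2 first.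
  - by apply: (measurableT_comp mh); exact: measurable_funD.
  - by move=> u; exact: h0.
  over.
move: p01 => /andP[p0 p1].
rewrite -(@integral_normal_partial_sum m (fun u => `|u - x| ^+ 3))//.
have mS : measurable_fun [set: T] (fun w => (`|partial_sum X m w - x| ^+ 3)%:E).
  by apply/measurable_EFinP; exact: (measurableT_comp mh).
have q0 : 0 <= 1 - p by rewrite subr_ge0.
rewrite -ge0_integralZl//.
rewrite -[X in (_ + X)%E](integral_probability_cst P) -ge0_integralD//; last 3 first.
- by move=> w _; rewrite -EFinM lee_fin mulr_ge0.
- by apply: emeasurable_funM.
- by move=> w _; rewrite lee_fin mulr_ge0// exprn_ge0.
apply: ge0_le_integral => //.
- by move=> w _; rewrite -EFinM -EFinD lee_fin addr_ge0// mulr_ge0// exprn_ge0.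
- by apply: emeasurable_funD => //; apply: emeasurable_funM.
- have mc c : measurable_fun [set: T]
      (fun w => `|partial_sum X m w + c - x| ^+ 3).
    by apply: (measurableT_comp mh); exact: measurable_funD.
  apply/measurable_EFinP; apply: measurable_funD; apply: measurable_funM => //.
  by apply: measurable_funM => //; apply: measurable_funD.
- move=> w _; rewrite -EFinM -EFinD lee_fin addr0 lerD2l ler_wpM2l//.
  have := jump_convexity (partial_sum X m w - x).
  by rewrite (addrAC _ M) (addrAC _ (- M)).
Qed.

End extremal_sum.

(** * Cost of shrinking the standard normal by the factor [1 - r] *)

Section near_extremal.
Context {R : realType}.
Local Notation gauss := (@std_normal R).

Let measurable_shifted_cube (x a : R) :
  measurable_fun [set: R] (fun z : R => `|a * z - x| ^+ 3).
Proof.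
apply: measurable_funX; apply: (measurableT_comp (@normr_measurable R setT)).
by apply: measurable_funD => //; exact: measurable_funM.
Qed.

Let measurable_dominating_cube (x : R) :
  measurable_fun [set: R] (fun z : R => (`|z| + `|x|) ^+ 3).
Proof.
by apply: measurable_funX; apply: measurable_funD.
Qed.

Lemma std_normal_dominating_lty (x : R) :
  (\int[gauss]_z ((`|z| + `|x|) ^+ 3)%:E < +oo)%E.
Proof.
have m3 : measurable_fun [set: R] (fun z : R => (`|z| ^+ 3)%:E).
  by apply/measurable_EFinP; apply: measurable_funX; exact: normr_measurable.
have m4 : measurable_fun [set: R] (fun z : R => 4%:E * (`|z| ^+ 3)%:E)%E.
  exact: emeasurable_funM.
apply: (@le_lt_trans _ _ (\int[gauss]_z
    (4%:E * (`|z| ^+ 3)%:E + (4 * `|x| ^+ 3)%:E))%E).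
  apply: ge0_le_integral => //.
  - by apply/measurable_EFinP; exact: measurable_dominating_cube.
  - have mB : measurable_fun [set: R]
        (fun z : R => 4 * `|z| ^+ 3 + 4 * `|x| ^+ 3).
      apply: measurable_funD => //; apply: measurable_funM => //.
      by apply: measurable_funX; exact: normr_measurable.
    by move/measurable_EFinP: mB.
  - move=> z _; rewrite -EFinM -EFinD lee_fin.
    have A0 := normr_ge0 z; have B0 := normr_ge0 x.
    move: A0 B0; set A := `|z|; set B := `|x| => A0 B0.
    rewrite -subr_ge0 [leRHS](_ : _ = 3 * ((A + B) * (A - B) ^+ 2)); last by ring.
    by rewrite mulr_ge0// mulr_ge0 ?sqr_ge0// addr_ge0.
rewrite ge0_integralD// integral_probability_cst ge0_integralZl//.
by rewrite lte_add_pinfty ?ltry// lte_mul_pinfty// std_normal_third_moment.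
Qed.

(** With [A = |(1 - r) * z - x|] and [D = |z| + |x|], one has [|z - x| <= A + r * D] and [A <= D].
    In the cube, each term other than [A ^+ 3] has a factor [r * D], and the cofactors add up to at
    most [(3 + 3 + 1) * D ^+ 2]. *)
Lemma std_normal_rescaling_le (x r : R) : 0 <= r <= 1 ->
  (\int[gauss]_z (`|z - x| ^+ 3)%:E <=
   \int[gauss]_z (`|(1 - r) * z - x| ^+ 3)%:E +
   (7 * r)%:E * \int[gauss]_z ((`|z| + `|x|) ^+ 3)%:E)%E.
Proof.
move=> /andP[r0 r1].
have mD : measurable_fun [set: R] (fun z : R => ((`|z| + `|x|) ^+ 3)%:E).
  by apply/measurable_EFinP; exact: measurable_dominating_cube.
have mC : measurable_fun [set: R] (fun z : R => (`|(1 - r) * z - x| ^+ 3)%:E).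
  by apply/measurable_EFinP; exact: measurable_shifted_cube.
have m1 : measurable_fun [set: R] (fun z : R => (`|z - x| ^+ 3)%:E).
  apply/measurable_EFinP; have := measurable_shifted_cube x 1.
  by under eq_fun do rewrite mul1r.
have m7 : measurable_fun [set: R]
    (fun z : R => (7 * r)%:E * ((`|z| + `|x|) ^+ 3)%:E)%E.
  exact: emeasurable_funM.
have D0 (z : R) : 0 <= (`|z| + `|x|) ^+ 3 by rewrite exprn_ge0// addr_ge0.
have r70 : 0 <= 7 * r by rewrite mulr_ge0.
rewrite -ge0_integralZl// -ge0_integralD//; last first.
  by move=> z _; rewrite mule_ge0 ?lee_fin.
apply: ge0_le_integral => //; first exact: emeasurable_funD.
move=> z _; rewrite -EFinM -EFinD lee_fin.
set A := `|(1 - r) * z - x|; set D := `|z| + `|x|.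
have D0' : 0 <= D by rewrite addr_ge0.
have A0 : 0 <= A by exact: normr_ge0.
have AD : A <= D.
  apply: le_trans (ler_normB _ _) _; rewrite lerD2r normrM ger0_norm ?subr_ge0//.
  by rewrite ler_piMl// gerBl.
have zA : `|z - x| <= A + r * D.
  rewrite (_ : z - x = ((1 - r) * z - x) + r * z); last by ring.
  apply: le_trans (ler_normD _ _) _; rewrite lerD2l normrM (ger0_norm r0).
  by rewrite ler_wpM2l// lerDl.
apply: (@le_trans _ _ ((A + r * D) ^+ 3)).
  by rewrite lerXn2r// nnegrE ?addr_ge0// mulr_ge0.
have rD0 : 0 <= r * D by rewrite mulr_ge0.
have rDD : r * D <= D by rewrite ler_piMl.
have AA : A ^+ 2 <= D ^+ 2 by rewrite lerXn2r.
have ArD : A * (r * D) <= D ^+ 2 by rewrite expr2 ler_pM.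
have rD2 : (r * D) ^+ 2 <= D ^+ 2 by rewrite lerXn2r.
rewrite [leLHS](_ : _ = A ^+ 3 +
  r * D * (3 * A ^+ 2 + 3 * (A * (r * D)) + (r * D) ^+ 2)); last by ring.
rewrite lerD2l [leRHS](_ : _ = r * D * (7 * D ^+ 2)); last by ring.
by rewrite ler_wpM2l//; lra.
Qed.

End near_extremal.

(** * Choice of the parameters of the near-extremal family *)

Section near_extremal_family.
Context {R : realType}.
Local Notation gauss := (@std_normal R).

(** The loss [r * (L + 7 * K + 1)] has three sources: [r * L] because the jump has probability
    [p <= r], [7 * r * K] from shrinking the normal part, and [r] because the jump only receives
    [gamma - r]. *)
Lemma exists_near_extremal (x gamma r L K : R) :
  (\int[gauss]_z (`|z - x| ^+ 3)%:E = L%:E)%E ->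
  (\int[gauss]_z ((`|z| + `|x|) ^+ 3)%:E = K%:E)%E ->
  0 < r -> 2 * r <= 1 -> 6 * r <= gamma ->
  exists (d : measure_display) (T : measurableType d) (P : probability T R)
      (n : nat) (X : 'I_n -> {RV P >-> R}),
    [/\ independent_RVs X,
        (forall i, 'E_P[X i] = 0)%E,
        (\sum_(i < n) 'E_P[fun w => (X i w ^+ 2)%R] <= 1)%E,
        (\sum_(i < n) 'E_P[fun w => (`|X i w| ^+ 3)%R] <= gamma%:E)%E &
        ((L + gamma - r * (L + 7 * K + 1))%:E <=
         'E_P[fun w => (`|\sum_(i < n) X i w - x| ^+ 3)%R])%E].
Proof.
move=> LE KE r0 r2 r6.
have r1 : r < 1 by lra.
pose c := fine (\int[gauss]_z (`|z| ^+ 3)%:E)%E.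
have c0 : 0 <= c by rewrite fine_ge0// integral_ge0// => z _; rewrite lee_fin exprn_ge0.
have cE : (\int[gauss]_z (`|z| ^+ 3)%:E = c%:E)%E.
  rewrite fineK// ge0_fin_numE ?std_normal_third_moment//.
  by apply: integral_ge0 => z _; rewrite lee_fin exprn_ge0.
have [q q0 cq] : exists2 q : nat, (0 < q)%N & c <= r * q%:R.
  exists (Num.bound (c / r)).+1 => //.
  rewrite -ler_pdivrMl// mulrC ltW// (lt_trans (archi_boundP _))//.
    by rewrite divr_ge0// ltW.
  by rewrite ltr_nat.
have qR0 : 0 < q%:R :> R by rewrite ltr0n.
(* A square number of normals gives total variance [(1 - r) ^+ 2] without a root in [s]; their total
   third moment is of order [1 / q]. *)
pose m := (q ^ 2)%N.
pose s := (1 - r) / q%:R.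
have s0 : 0 <= s by rewrite divr_ge0 ?ler0n// subr_ge0 ltW.
have ms2 : m%:R * s ^+ 2 = (1 - r) ^+ 2.
  by rewrite /m /s natrX; field; rewrite gt_eqF.
pose eps := 1 - (1 - r) ^+ 2.
have eps0 : 0 < eps by rewrite /eps; nra.
have eps2r : eps <= 2 * r by rewrite /eps; nra.
pose g := gamma - r.
have g0 : 0 < g by rewrite /g; lra.
have g5 : 5 * r <= g by rewrite /g; lra.
(* solving [p * M ^+ 2 = eps] and [p * M ^+ 3 = g] *)
pose p := eps ^+ 3 / g ^+ 2.
pose M := g / eps.
have M0 : 0 <= M by rewrite divr_ge0// ltW.
have pM2 : p * M ^+ 2 = eps by rewrite /p /M; field; rewrite !gt_eqF.
have pM3 : p * M ^+ 3 = g by rewrite /p /M; field; rewrite !gt_eqF.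
have p0 : 0 <= p by rewrite divr_ge0// exprn_ge0// ltW.
(* From [eps <= 2 * r] and [5 * r <= g], the quotient [p] is at most [8 / 25 * r]. *)
have pr : p <= r.
  rewrite ler_pdivrMr ?exprn_gt0//.
  apply: (@le_trans _ _ ((2 * r) ^+ 3)).
    by rewrite lerXn2r// nnegrE ltW// mulr_gt0.
  apply: (@le_trans _ _ (r * (5 * r) ^+ 2)).
    rewrite -subr_ge0 [leRHS](_ : _ = 17 * r ^+ 3); last by ring.
    by rewrite mulr_ge0// exprn_ge0// ltW.
  by rewrite ler_wpM2l ?(ltW r0)// lerXn2r// nnegrE ltW// mulr_gt0.
have p01 : 0 <= p <= 1 by rewrite p0 (le_trans pr)// ltW.
pose mu i := if (i < m)%N then scaled_normal s else jump_law p M.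
have [d [T [P [X [indX lawX]]]]] := exists_independent_RVs mu m.+1.
have lawX' (i : 'I_m.+1) (B : set R) : measurable B ->
    P (X i @^-1` B) = (if (i < m)%N then scaled_normal s else jump_law p M) B.
  by move=> mB; rewrite lawX// /mu; case: ifP.
have mcube : measurable_fun [set: R] (fun u : R => `|u| ^+ 3).
  by apply: measurable_funX; exact: normr_measurable.
have mcubeE : measurable_fun [set: R] (fun u : R => (`|u| ^+ 3)%:E).
  exact/measurable_EFinP.
have msqE : measurable_fun [set: R] (fun u : R => (u ^+ 2)%:E).
  by apply/measurable_EFinP; exact: measurable_funX.
have sq0 (u : R) : (0 <= (u ^+ 2)%:E)%E by rewrite lee_fin sqr_ge0.
have normalE := @integral_normal_summand R d T P m X s p M lawX'.
have jumpE := @integral_jump_summand R d T P m X s p M p01 lawX'.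
have sqN (i : 'I_m.+1) : (i < m)%N ->
    ('E_P[fun w => (X i w ^+ 2)%R] = (s ^+ 2)%:E)%E.
  move=> im; rewrite expectationE (normalE i (fun u => (u ^+ 2)%:E))//.
  under eq_integral do rewrite exprMn EFinM.
  rewrite ge0_integralZl// ?lee_fin ?sqr_ge0//.
  by rewrite std_normal_second_moment mule1.
have sqJ : ('E_P[fun w => (X ord_max w ^+ 2)%R] = eps%:E)%E.
  rewrite expectationE (jumpE (fun u => u ^+ 2)); last 2 first.
  - exact: measurable_funX.
  - by move=> u; rewrite sqr_ge0.
  by rewrite -pM2; congr EFin; field.
have cubeN (i : 'I_m.+1) : (i < m)%N ->
    ('E_P[fun w => (`|X i w| ^+ 3)%R] = (s ^+ 3 * c)%:E)%E.
  move=> im; rewrite expectationE (normalE i (fun u => (`|u| ^+ 3)%:E))//.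
  under eq_integral do rewrite normrM (ger0_norm s0) exprMn EFinM.
  by rewrite ge0_integralZl// ?cE// lee_fin exprn_ge0.
have cubeJ : ('E_P[fun w => (`|X ord_max w| ^+ 3)%R] = g%:E)%E.
  rewrite expectationE (jumpE (fun u => `|u| ^+ 3)); last 2 first.
  - exact: mcube.
  - by move=> u; rewrite exprn_ge0.
  by rewrite normr0 normrN ger0_norm// -pM3; congr EFin; field.
have max_or (i : 'I_m.+1) : (i < m)%N \/ i = ord_max.
  by have := ltn_ord i; rewrite ltnS leq_eqVlt => /predU1P[im|]; [right; exact: val_inj|left].
have sumE (F : 'I_m.+1 -> \bar R) (a b : R) :
    (forall i : 'I_m.+1, (i < m)%N -> F i = a%:E) -> F ord_max = b%:E ->
    (\sum_(i < m.+1) F i = (m%:R * a + b)%:E)%E.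
  move=> Fa Fb; rewrite big_ord_recr/= Fb (eq_bigr (fun=> a%:E)); last first.
    by move=> i _; rewrite Fa//= ltn_ord.
  by rewrite sumEFin sumr_const card_ord EFinD mulr_natl.
exists d, T, P, m.+1, X; split => //.
- move=> i; apply: expectation_symmetric.
    by case: (max_or i) => [/sqN ->|->]; rewrite ?sqJ ltry.
  have mpos : measurable_fun [set: R] (@pos_part R).
    exact: continuous_measurable_fun (@continuous_pos_part R).
  have mposN : measurable_fun [set: R] (fun u : R => pos_part (- u)).
    by apply: (measurableT_comp mpos); exact: oppr_measurable.
  case: (max_or i) => [im|->]; last first.
    rewrite (jumpE _ mpos (@pos_part_ge0 R)) (jumpE _ mposN (fun u => pos_part_ge0 _)).
    by rewrite oppr0 opprK (addrC (pos_part (- M))).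
  rewrite (normalE i (fun u => (pos_part u)%:E))//; last 2 first.
  - exact/measurable_EFinP.
  - by move=> u; rewrite lee_fin pos_part_ge0.
  rewrite (normalE i (fun u => (pos_part (- u))%:E))//; last 2 first.
  - exact/measurable_EFinP.
  - by move=> u; rewrite lee_fin pos_part_ge0.
  rewrite -(std_normal_symmetric (f := fun z => (pos_part (s * z))%:E)).
  - by apply: eq_integral => z _; rewrite mulrN.
  - apply/measurable_EFinP; apply: (measurableT_comp mpos).
    exact: measurable_funM.
  - by move=> z; rewrite lee_fin pos_part_ge0.
- by rewrite (sumE _ _ _ sqN sqJ) lee_fin ms2 /eps subrKC.
- rewrite (sumE _ _ _ cubeN cubeJ) lee_fin.
  (* The normals contribute at most [c / q <= r], exactly the share of [gamma] left by the jump. *)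
  rewrite [leLHS](_ : _ = (m%:R * s ^+ 2) * s * c + g); last by ring.
  rewrite ms2 -lerBrDr (_ : gamma - g = r); last by rewrite /g; ring.
  rewrite [leLHS](_ : _ = (1 - r) ^+ 3 * (c / q%:R)); last first.
    by rewrite /s; field; rewrite gt_eqF.
  apply: (@le_trans _ _ (c / q%:R)); last by rewrite ler_pdivrMr.
  rewrite ler_piMl ?divr_ge0 ?ler0n// exprn_ile1 ?subr_ge0 ?(ltW r1)//.
  by rewrite gerBl ltW.
- rewrite expectationE.
  apply: le_trans (integral_normr3_extremal_ge indX s0 p01 M0 lawX' x).
  rewrite ms2 sqrtr_sqr ger0_norm ?subr_ge0 ?(ltW r1)// pM3.
  have L0 : 0 <= L by rewrite -lee_fin -LE integral_ge0// => z _; rewrite lee_fin exprn_ge0.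
  have K0 : 0 <= K.
    by rewrite -lee_fin -KE integral_ge0// => z _; rewrite lee_fin exprn_ge0// addr_ge0.
  have r01 : 0 <= r <= 1 by rewrite !ltW.
  have := std_normal_rescaling_le x r01; rewrite LE KE.
  have : (0 <= \int[gauss]_z (`|(1 - r) * z - x| ^+ 3)%:E)%E.
    by apply: integral_ge0 => z _; rewrite lee_fin exprn_ge0.
  (* An infinite integral makes the lower bound trivial, as [1 - p > 0]; otherwise the rescaling
     estimate is an inequality between reals. *)
  case: (\int[gauss]_z _)%E => [N N0 LN| _ _|//]; last first.
    have q1 : (0 < (1 - p)%:E)%E by rewrite lte_fin subr_gt0 (le_lt_trans pr).
    by rewrite (gt0_muley q1) addye// leey.
  rewrite -EFinM -EFinD lee_fin in LN; rewrite -EFinM -EFinD lee_fin.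
  have : (1 - p) * L <= (1 - p) * (N + 7 * r * K).
    by rewrite ler_wpM2l// subr_ge0 (le_trans pr)// ltW.
  have pL : p * L <= r * L by rewrite ler_wpM2r.
  have pK : 0 <= p * (7 * r * K) by rewrite mulr_ge0// mulr_ge0// mulr_ge0// ltW.
  rewrite /g !mulrBl !mul1r mulrDr; lra.
Qed.

End near_extremal_family.

Theorem mainTheorem2 (R : realType)
    (dZ : measure_display) (TZ : measurableType dZ) (PZ : probability TZ R)
    (Z : {RV PZ >-> R}) (hZ : standard_normal Z) :
  (forall (beta : R) (d : measure_display) (T : measurableType d)
      (P : probability T R) (n : nat) (X : 'I_n -> {RV P >-> R}),
    0 < beta ->
    independent_RVs X ->
    (forall i, 'E_P[X i] <= 0)%E ->
    (\sum_(i < n) 'E_P[fun w => (X i w ^+ 2)%R] <= 1)%E ->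
    (\sum_(i < n) 'E_P[fun w => (pos_part (X i w) ^+ 3)%R] <= beta%:E)%E ->
    forall x : R,
      ('E_P[fun w => (pos_part (\sum_(i < n) X i w - x) ^+ 3)%R]
       <= 'E_PZ[fun w => (pos_part (Z w - x) ^+ 3)%R] + beta%:E)%E)
  /\
  (forall (beta : R) (d : measure_display) (T : measurableType d)
      (P : probability T R) (n : nat) (X : 'I_n -> {RV P >-> R}),
    0 < beta ->
    independent_RVs X ->
    (forall i, 'E_P[X i] <= 0)%E ->
    (\sum_(i < n) 'E_P[fun w => (X i w ^+ 2)%R] <= 1)%E ->
    (\sum_(i < n) 'E_P[fun w => (pos_part (X i w) ^+ 3)%R] <= beta%:E)%E ->
    (forall i, 'E_P[X i] = 0)%E ->
    forall x : R,
      ('E_P[fun w => (`|\sum_(i < n) X i w - x| ^+ 3)%R]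
       <= 'E_PZ[fun w => (`|Z w - x| ^+ 3)%R]
          + \sum_(i < n) 'E_P[fun w => (`|X i w| ^+ 3)%R])%E)
  /\
  (forall (x gamma : R), 0 < gamma ->
    ereal_sup [set e : \bar R |
      exists (d : measure_display) (T : measurableType d)
          (P : probability T R) (n : nat) (X : 'I_n -> {RV P >-> R}),
        [/\ independent_RVs X,
            (forall i, 'E_P[X i] = 0)%E,
            (\sum_(i < n) 'E_P[fun w => (X i w ^+ 2)%R] <= 1)%E,
            (\sum_(i < n) 'E_P[fun w => (`|X i w| ^+ 3)%R] <= gamma%:E)%E
          & e = 'E_P[fun w => (`|\sum_(i < n) X i w - x| ^+ 3)%R]%E]]
    = ('E_PZ[fun w => (`|Z w - x| ^+ 3)%R] + gamma%:E)%E).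
Proof.
have mcubex (x : R) : measurable_fun [set: R] (fun z : R => `|z - x| ^+ 3).
  apply: measurable_funX; apply: (measurableT_comp (@normr_measurable R setT)).
  exact: measurable_funD.
have Zcube (x : R) := expectation_standard_normal (h := fun z => `|z - x| ^+ 3)
  hZ (mcubex x) (fun z => exprn_ge0 3 (normr_ge0 (z - x))).
split; [|split].
- move=> beta d T P n X _ indX X1 X2 X3 x.
  rewrite (expectation_standard_normal (h := fun z => pos_part (z - x) ^+ 3) hZ).
  + apply: le_trans (expectation_pos_part3_le x indX X1 X2) _.
    exact: leeD2l.
  + apply: (measurableT_comp measurable_pos_part3); exact: measurable_funD.
  + by move=> z; exact: pos_part3_ge0.
- move=> beta d T P n X _ indX _ X2 _ X0 x.
  by rewrite Zcube; exact: expectation_normr3_le.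
move=> x gamma gamma0; rewrite Zcube.
have dom_fin := std_normal_dominating_lty x.
have [K K0 KE] : exists2 K : R, 0 <= K &
    (\int[std_normal]_z ((`|z| + `|x|) ^+ 3)%:E = K%:E)%E.
  have K0 : (0 <= \int[@std_normal R]_z ((`|z| + `|x|) ^+ 3)%:E)%E.
    by apply: integral_ge0 => z _; rewrite lee_fin exprn_ge0// addr_ge0.
  exists (fine (\int[std_normal]_z ((`|z| + `|x|) ^+ 3)%:E)%E).
    exact: fine_ge0.
  by rewrite fineK// ge0_fin_numE.
have [L L0 LE] : exists2 L : R, 0 <= L &
    (\int[std_normal]_z (`|z - x| ^+ 3)%:E = L%:E)%E.
  have L0 : (0 <= \int[@std_normal R]_z (`|z - x| ^+ 3)%:E)%E.
    by apply: integral_ge0 => z _; rewrite lee_fin exprn_ge0.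
  exists (fine (\int[std_normal]_z (`|z - x| ^+ 3)%:E)%E); first exact: fine_ge0.
  rewrite fineK// ge0_fin_numE//; apply: le_lt_trans dom_fin.
  apply: ge0_le_integral => //.
  - by apply/measurable_EFinP; exact: mcubex.
  - by apply/measurable_EFinP; apply: measurable_funX; apply: measurable_funD.
  - move=> z _; rewrite lee_fin lerXn2r ?nnegrE ?addr_ge0//.
    exact: ler_normB.
rewrite LE; apply/eqP; rewrite eq_le; apply/andP; split.
  apply: ge_ereal_sup => _ [d [T [P [n [X [indX X0 X2 X3 ->]]]]]].
  apply: le_trans (expectation_normr3_le x indX X0 X2) _.
  by rewrite LE; exact: leeD2l.
pose D := L + 7 * K + 1.
have D0 : 0 < D by rewrite /D; lra.
apply/lee_addgt0Pr => e e0.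
(* The first two bounds make the construction available, and the third keeps its loss [r * D] below
   [e]. *)
pose r := Num.min (Num.min (2^-1) (gamma / 6)) (e / D).
have r0 : 0 < r by rewrite !lt_min invr_gt0 ltr0n/= !divr_gt0.
have r2 : 2 * r <= 1.
  by rewrite mulrC -ler_pdivlMr// mul1r !ge_min lexx.
have r6 : 6 * r <= gamma.
  by rewrite mulrC -ler_pdivlMr// !ge_min lexx orbT.
have re : r * D <= e by rewrite -ler_pdivlMr// ge_min lexx orbT.
have [d [T [P [n [X [indX X0 X2 X3 lower]]]]]] := exists_near_extremal LE KE r0 r2 r6.
apply: (@le_trans _ _ ((L + gamma - r * D)%:E + e%:E)%E).
  by rewrite -!EFinD lee_fin; lra.
rewrite leeD2r// (le_trans lower)//; apply: ereal_sup_ubound.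
by exists d, T, P, n, X.
Qed.
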